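(* Let $A_q$ be a translation plane of order $q=p^h$ ($p$ prime), and let $(d_1),(d_2),(d_3)$ be three distinct directions of $A_q$. Represent $A_q$ as $(\mathbb F_q^2,\mathcal L')$ (i.e. with point set $\mathbb F_q^2$) in such a way that its lines with directions $(d_1),(d_2),(d_3)$ are exactly the lines of $\mathrm{AG}(2,q)$ with directions $(\infty),(0),(1)$, respectively (such a representation exists). Then an integer multiset on $\mathbb F_q^2$ has exactly $(d_1),(d_2),(d_3)$ as its inequidistributed directions in $A_q$ if and only if it has exactly $(\infty),(0),(1)$ as its inequidistributed directions in $\mathrm{AG}(2,q)$. Consequently, if $S$ is an integer multiset on $\mathbb F_q^2$ whose inequidistributed directions in $A_q$ are exactly $(d_1),(d_2),(d_3)$, then there is an affine transformation $\varphi$ of $\mathrm{AG}(2,q)$ such that $\mu_{S^\varphi}\in\mathbb Z\mathcal L(\{(\infty),(0),(1)\})$ or $\mu_{S^\varphi}\in\mu_{\mathrm{Lift}(K)}+\mathbb Z\mathcal L(\{(\infty),(0),(1)\})$; and if $S$ is moreover an ordinary set, then $S$ is affinely equivalent in $\mathrm{AG}(2,q)$ to the union of $\mathrm{Lift}(K)$ and some (possibly no) parallel lines of $\mathrm{AG}(2,q)$ disjoint from $\mathrm{Lift}(K)$.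
   Context: A translation of a finite affine plane is either the identity or a collineation that maps each line to a parallel line and has no fixed points. An affine plane is a translation plane if its translations act transitively on the points. A direction of an affine plane is a parallel class of lines. $\mathrm{AG}(2,q)$ is the Desarguesian affine plane with point set $\mathbb F_q^2$ and line set $\mathcal L$. Its directions are $(d)$, $d\in\mathbb F_q\cup\{\infty\}$: for $d\in\mathbb F_q$ the lines with direction $(d)$ are $Y=dX+b$, and the lines with direction $(\infty)$ are $X=a$; $\operatorname{dir}(\ell)$ denotes the direction of $\ell$. An integer multiset $S$ on $\mathbb F_q^2$ is given by a multiplicity function $\mu_S:\mathbb F_q^2\to\mathbb Z$ (negative values allowed; ordinary sets are those with values in $\{0,1\}$). For a line $\ell$ of either plane, $|S\cap\ell|=\sum_{P\in\ell}\mu_S(P)$. $S$ is equidistributed from a direction if $|S\cap\ell|$ is the same for all lines $\ell$ with that direction, and inequidistributed from it otherwise. Affine transformations of $\mathrm{AG}(2,q)$ are the maps $v\mapsto Mv+b$ with $M\in\mathrm{GL}(2,q)$, $b\in\mathbb F_q^2$; $\mu_{S^\varphi}=\mu_S\circ\varphi^{-1}$; two multisets are affinely equivalent if one is the image of the other under an affine transformation. For a line $\ell$ of $\mathrm{AG}(2,q)$, $\mu_\ell$ is its characteristic function, and for a set $D$ of directions of $\mathrm{AG}(2,q)$, $\mathbb Z\mathcal L(D)=\left\{\sum_{\ell\in\mathcal L,\ \operatorname{dir}(\ell)\in D}c_\ell\mu_\ell : c_\ell\in\mathbb Z\right\}$. Let $\operatorname{Tr}:\mathbb F_q\to\mathbb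 F_p$ be the absolute trace and $\nu:\mathbb F_p\to\{0,\dots,p-1\}$ the natural choice of integer representatives. $K=\{(x,y)\in\mathbb F_p^2:\nu(x)<\nu(y)\}$ and $\mathrm{Lift}(K)=\{(x,y)\in\mathbb F_q^2:\nu(\operatorname{Tr}(x))<\nu(\operatorname{Tr}(y))\}$. *)

(* Defs.v *)
From mathcomp Require Import all_boot all_order all_fingroup all_algebra all_field.

Set Implicit Arguments.
Unset Strict Implicit.
Unset Printing Implicit Defensive.

Import GRing.Theory.
Local Open Scope ring_scope.

(* A plane with point set [P] is given by its set of lines [L], each line being
   the set of its points. *)
Section Planes.
Variables (P : finType) (L : {set {set P}}).

Definition parallel (l m : {set P}) : bool := (l == m) || [disjoint l & m].

Definition affine_plane : Prop :=
  [/\ forall x y : P, x != y ->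
        exists! l : {set P}, [/\ l \in L, x \in l & y \in l],
      forall (x : P) (l : {set P}), l \in L -> x \notin l ->
        exists! m : {set P}, [/\ m \in L, x \in m & [disjoint l & m]]
    & exists x y z : P, [/\ x != y, x != z, y != z &
        forall l : {set P}, l \in L -> ~~ [&& x \in l, y \in l & z \in l]]].

Definition plane_order (n : nat) : Prop := {in L, forall l : {set P}, #|l| = n}.

Definition dir (l : {set P}) : {set {set P}} := [set m in L | parallel l m].

Definition directions : {set {set {set P}}} := [set dir l | l in L].

Definition collineation (g : {perm P}) : Prop :=
  forall l : {set P}, (g @: l \in L) = (l \in L).

Definition translation (g : {perm P}) : Prop :=
  g = 1%g \/
  [/\ collineation g,
      forall l : {set P}, l \in L -> parallel l (g @: l)
    & forall x : P, g x != x].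

Definition translation_plane : Prop :=
  affine_plane /\
  forall x y : P, exists g : {perm P}, translation g /\ g x = y.

Definition charfun (A : {set P}) : {ffun P -> int} := [ffun x => (x \in A)%:R].

Definition meet_size (mu : {ffun P -> int}) (l : {set P}) : int :=
  \sum_(x in l) mu x.

Definition equidistributed (mu : {ffun P -> int}) (D : {set {set P}}) : bool :=
  [forall l in D, forall m in D, meet_size mu l == meet_size mu m].

Definition inequidistributed_dirs (mu : {ffun P -> int}) : {set {set {set P}}} :=
  [set D in directions | ~~ equidistributed mu D].

Definition ordinary_set (mu : {ffun P -> int}) : Prop :=
  forall x : P, mu x = 0 \/ mu x = 1.

Definition mimage (g : {perm P}) (mu : {ffun P -> int}) : {ffun P -> int} :=
  [ffun x => mu (g^-1%g x)].

Definition ZL (D : {set {set {set P}}}) (mu : {ffun P -> int}) : Prop :=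
  exists c : {set P} -> int,
    mu = [ffun x => \sum_(l in L | dir l \in D) c l * charfun l x].

End Planes.

Definition transport (P Q : finType) (f : P -> Q) (D : {set {set P}}) :
  {set {set Q}} := [set f @: l | l : {set P} in D].

Section AG.
Variable F : finFieldType.

(* [Some d] stands for the slope [d], and [None] for the slope infinity. *)
Definition AGline (d : option F) (b : F) : {set 'cV[F]_2} :=
  [set v : 'cV[F]_2 |
    if d is Some m then v 1 0 == m * v 0 0 + b else v 0 0 == b].

Definition AGdir (d : option F) : {set {set 'cV[F]_2}} :=
  [set AGline d b | b : F].

Definition AG : {set {set 'cV[F]_2}} := \bigcup_(d : option F) AGdir d.

Definition affine_transformation (g : {perm 'cV[F]_2}) : Prop :=
  exists (M : 'M[F]_2) (b : 'cV[F]_2),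
    M \in unitmx /\ forall v : 'cV[F]_2, g v = M *m v + b.

Definition affinely_equivalent (mu nu : {ffun 'cV[F]_2 -> int}) : Prop :=
  exists g : {perm 'cV[F]_2}, affine_transformation g /\ mimage g mu = nu.

(* The sum of conjugates, read in 'F_p.  The default value is never used when
   [F] has characteristic [p]: see [absTrP]. *)
Definition absTr (p : nat) (x : F) : 'F_p :=
  odflt 0 [pick c : 'F_p |
    (c : nat)%:R == \sum_(i < logn p #|F|) x ^+ (p ^ i)].

Definition Lift (p : nat) (A : {set 'cV['F_p]_2}) : {set 'cV[F]_2} :=
  [set v : 'cV[F]_2 | map_mx (absTr p) v \in A].

End AG.

(* The coercion from ['F_p] to [nat] (an ordinal seen as a number) gives the
   representative in {0, ..., p - 1} when [p] is prime. *)
Definition Kset (p : nat) : {set 'cV['F_p]_2} :=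
  [set v : 'cV['F_p]_2 | (v 0%R 0%R < v 1%R 0%R)%N].

Lemma absTrP (p h : nat) (F : finFieldType) (x : F) :
  prime p -> #|F| = (p ^ h)%N ->
  (absTr p x : nat)%:R = \sum_(i < h) x ^+ (p ^ i) :> F.
Proof.
move=> pr_p cardF; have chF := card_finPcharP cardF pr_p.
rewrite /absTr cardF pfactorK //; set y := \sum_(i < h) _.
case: pickP => [c /eqP //| noc]; exfalso.
have h_gt0: (0 < h)%N.
  by case: h cardF @y noc => // /eqP; rewrite eqn_leq leqNgt finNzRing_gt1.
have yp: y ^+ p = y.
  rewrite -(pFrobenius_autE chF) /y rmorph_sum /= -(prednK h_gt0).
  rewrite big_ord_recr big_ord_recl /= addrC !pFrobenius_autE -exprM -expnSr.
  rewrite prednK // -cardF expf_card expn0 expr1; congr (_ + _).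
  by apply: eq_bigr => i _; rewrite pFrobenius_autE -exprM -expnSr.
pose s := y :: [seq (c : nat)%:R | c : 'F_p].
have p_gt1 := prime_gt1 pr_p.
have szq: size ('X^p - 'X : {poly F}) = p.+1.
  by rewrite size_polyDl ?size_polyXn // size_polyN size_polyX ltnS.
have ncF (c : 'F_p) : (c < p)%N.
  by have := ltn_ord c; rewrite [X in (_ < X)%N -> _](Fp_cast pr_p).
have us: uniq s.
  rewrite /= map_inj_uniq ?enum_uniq ?andbT.
    by apply/negP => /mapP[c _ yc]; have := noc c; rewrite yc eqxx.
  move=> c d; wlog lecd: c d / (c <= d)%N => [W | /esym/eqP].
    by case/orP: (leq_total c d) => /W H E; [exact: H | apply/esym/H].
  rewrite -subr_eq0 -natrB // -(dvdn_pcharf chF) => /eqP dv.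
  apply/val_inj/eqP; rewrite /= eqn_leq lecd /= -subn_eq0.
  have: (d - c < p)%N by apply: leq_ltn_trans (ncF d); exact: leq_subr.
  by move/modn_small => <-; rewrite dv.
have rs: all (root ('X^p - 'X : {poly F})) s.
  apply/allP => z; rewrite inE /root !hornerE => /predU1P[->|/mapP[c _ ->]].
    by rewrite yp subrr.
  by rewrite -(pFrobenius_autE chF) rmorph_nat subrr.
have := max_poly_roots _ rs us.
rewrite -size_poly_eq0 szq /= size_map -cardE card_Fp // ltnn.
by move/(_ isT).
Qed.

Lemma directions_AG (F : finFieldType) :
  directions (AG F) = [set AGdir d | d : option F].
Proof.
have dirE (d : option F) (b : F) : dir (AG F) (AGline d b) = AGdir d.
  apply/setP => m; rewrite inE; apply/andP/imsetP => [[] | [c _ ->]].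
    case/bigcupP => e _ /imsetP[c _ ->] par.
    case: (eqVneq e d) => [->|ned]; first by exists c.
    have [v vd ve]: exists2 v, v \in AGline d b & v \in AGline e c.
      pose mk (x y : F) : 'cV[F]_2 := \col_i (if i == 0 then x else y).
      case: d e ned {par} => [d|] [e|] ned; last by rewrite eqxx in ned.
      - have nz: d - e != 0.
          by rewrite subr_eq0; apply: contraNneq ned => ->.
        pose x := (c - b) / (d - e).
        have E: (d - e) * x = c - b by rewrite /x mulrC divfK.
        exists (mk x (d * x + b)); rewrite !inE !mxE //=.
        rewrite -subr_eq0 opprD addrACA -mulrBl E.
        by rewrite addrA subrK subrr.
      - by exists (mk c (d * c + b)); rewrite !inE !mxE /=.
      - by exists (mk b (e * b + c)); rewrite !inE !mxE /=.
    case/orP: par => [/eqP E | /disjointFr/(_ vd)]; last by rewrite ve.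
    by exists b.
  split; first by apply/bigcupP; exists d => //; apply: imset_f.
  apply/orP; case: (eqVneq b c) => [->|nbc]; [by left | right].
  rewrite -setI_eq0; apply/eqP/setP => v; rewrite !inE.
  apply/negP => /andP[]; case: d => [d|] /eqP->; last by rewrite (negPf nbc).
  by rewrite (inj_eq (addrI _)) (negPf nbc).
apply/setP => D; apply/imsetP/imsetP => [[l] | [d _ ->]].
  by case/bigcupP => d _ /imsetP[b _ ->] ->; exists d; rewrite ?dirE.
exists (AGline d 0); last by rewrite dirE.
by apply/bigcupP; exists d => //; apply: imset_f.
Qed.

(* Main.v *)
(** In any affine plane of order [q] on the points of [F], summing a multiset
    over the lines through a point gives
    [q * mu x = A x + B x + C x + k], where [A], [B], [C] are the numbers of
    points on the three special lines through [x], as soon as all the other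
    directions are equidistributed; conversely such an identity makes them
    equidistributed, since a line of another direction is a transversal of each
    of the three.  The condition does not mention the other lines, whence the
    equivalence between the two planes.  The diagonal of a representation is
    labelled by an isomorphism from [F] to the group of translations in the third
    direction, an elementary abelian group of order [q].

    In coordinates, [A x + B y + C (y - x) + k = 0] modulo [q] forces [A], [B]
    and [C] to be, up to constants and modulo [q], multiples by [q / p] of the
    representative of the same form [x |-> Tr (a x)], and the carry identity
    [p * (c < d) = d - c + (c - d mod p)] identifies the fractional part with
    the lift of [K].  For an ordinary set without full special lines, the line
    sums lie in [0, q - 1], hence are known from their residues, and this pins
    the set down to a translate of the lift. *)
Require Import Defs.
From mathcomp Require Import all_boot all_order all_fingroup all_algebra all_field.
From mathcomp Require Import all_solvable zify ring.
Set Implicit Arguments.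
Unset Strict Implicit.
Unset Printing Implicit Defensive.
Import Order.TTheory GRing.Theory Num.Theory.
Local Open Scope ring_scope.

(** * Affine planes described by the partitions of their directions *)

Lemma pblock_refl (P : finType) (D : {set {set P}}) x :
  partition D [set: P] -> x \in pblock D x.
Proof. by move=> pD; rewrite mem_pblock (cover_partition pD) inE. Qed.

Lemma pblock_line (P : finType) (D : {set {set P}}) x :
  partition D [set: P] -> pblock D x \in D.
Proof. by move=> pD; rewrite pblock_mem // (cover_partition pD) inE. Qed.

Lemma pblock_def (P : finType) (D : {set {set P}}) l x :
  partition D [set: P] -> l \in D -> x \in l -> pblock D x = l.
Proof. by move=> /partition_trivIset tD; apply: def_pblock. Qed.

Lemma mem_pblockE (P : finType) (D : {set {set P}}) x y :
  partition D [set: P] -> (y \in pblock D x) = (pblock D x == pblock D y).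
Proof.
move=> pD; rewrite eq_pblock ?(cover_partition pD) ?inE //.
exact: partition_trivIset pD.
Qed.

(* An affine plane seen through its directions only: every direction [D] is a
   partition of the points, and [pblock D x] is its line through [x]. *)
Definition plane_of_directions (P : finType) (Ds : {set {set {set P}}}) : Prop :=
  [/\ {in Ds, forall D, partition D [set: P]},
      forall D E l m, D \in Ds -> E \in Ds -> D != E -> l \in D -> m \in E ->
       #|l :&: m| = 1%N
    & forall x y : P, exists2 D, D \in Ds & pblock D x = pblock D y].

Section AffinePlane.
Variables (P : finType) (L : {set {set P}}).
Hypotheses (affL : affine_plane L) (L_n0 : set0 \notin L).

Lemma parallel_sym (l m : {set P}) : parallel l m = parallel m l.
Proof. by rewrite /parallel eq_sym disjoint_sym. Qed.

(** If [l] and [k], both disjoint from [m], share a point, then each is the parallel to [m] through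
    that point, so uniqueness of the parallel identifies them. *)
Lemma parallel_trans (l m k : {set P}) : l \in L -> m \in L -> k \in L ->
  parallel l m -> parallel m k -> parallel l k.
Proof.
case: affL => _ uniqp _ lL mL kL /predU1P[-> //|dlm] /predU1P[<-|dmk].
  by rewrite /parallel dlm orbT.
rewrite /parallel; case: (boolP [disjoint l & k]) => [_|]; first by rewrite orbT.
rewrite -setI_eq0 => /set0Pn[x /setIP[xl xk]].
have xm : x \notin m by rewrite (disjointFr dlm).
have [n [_ un]] := uniqp x m mL xm.
have nl : n = l by apply: un; split=> //; rewrite disjoint_sym.
have nk : n = k by apply: un.
by rewrite -nl nk eqxx.
Qed.

Lemma dir_eqP (l m : {set P}) : l \in L -> m \in L ->
  reflect (dir L l = dir L m) (parallel l m).
Proof.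
move=> lL mL; apply: (iffP idP) => [lm|/setP/(_ m)].
  apply/setP => k; rewrite !inE; case kL: (k \in L) => //=.
  apply/idP/idP => ?; last exact: (parallel_trans lL mL).
  by apply: (parallel_trans mL lL) => //; rewrite parallel_sym.
by rewrite !inE mL /= /parallel eqxx /= => ->.
Qed.

Lemma mem_directions D l : D \in directions L -> l \in D -> l \in L /\ D = dir L l.
Proof.
case/imsetP => m mL -> lD; have: l \in L by move: lD; rewrite inE => /andP[].
by move=> lL; split=> //; apply/dir_eqP => //; move: lD; rewrite inE => /andP[].
Qed.

Lemma partition_directions D : D \in directions L -> partition D [set: P].
Proof.
move=> DL; apply/and3P; split.
- apply/eqP/setP => x; rewrite inE; apply/bigcupP.
  case/imsetP: DL => l lL ->; case: (boolP (x \in l)) => [xl|xl].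
    by exists l => //; rewrite inE lL /parallel eqxx.
  have [_ uniqp _] := affL; have [m [[mL xm dml] _]] := uniqp x l lL xl.
  by exists m => //; rewrite inE mL /parallel dml orbT.
- apply/trivIsetP => l m lD mD lm.
  have [lL Dl] := mem_directions DL lD; have [mL Dm] := mem_directions DL mD.
  have: parallel l m by apply/dir_eqP; rewrite // -Dl.
  by rewrite /parallel (negPf lm).
- by apply: contra L_n0 => /(mem_directions DL)[].
Qed.

(** Lines of distinct directions are not parallel, hence meet; a second common point would make them
    equal, by uniqueness of the joining line. *)
Lemma affine_plane_directions : plane_of_directions (directions L).
Proof.
have [uniql _ [x0 [y0 [z0 [xy xz yz _]]]]] := affL.
split; first exact: partition_directions.
- move=> D E l m DL EL DE lD mE.
  have [lL Dl] := mem_directions DL lD; have [mL Em] := mem_directions EL mE.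
  have: ~~ parallel l m by apply: contra DE => lm; rewrite Dl Em; apply/eqP/dir_eqP.
  rewrite negb_or -setI_eq0 => /andP[lm /set0Pn[x xlm]].
  apply/eqP/cards1P; exists x; apply/setP => y; rewrite inE.
  apply/idP/eqP => [ylm|-> //]; apply/eqP; apply: contraNT lm => yx.
  have [k [_ uk]] := uniql y x yx; case/setIP: xlm => xl xm.
  case/setIP: ylm => yl ym; have kl : k = l by apply: uk.
  by apply/eqP; rewrite -kl; apply: uk.
move=> x y.
have [l [lL xl yl]] : exists l : {set P}, [/\ l \in L, x \in l & y \in l].
  have ex (u v : P) : u != v -> exists l : {set P}, [/\ l \in L, u \in l & v \in l].
    by move/uniql => [l [? _]]; exists l.
  case: (eqVneq x y) => [<-|]; last exact: ex.
  (* For [x = y] a line through [x] is still needed: join [x] to [x0], or to [y0] when [x = x0]. *)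
  have [ux|nux] := eqVneq x x0; last by have [l []] := ex _ _ nux; exists l.
  by rewrite ux; have [l []] := ex _ _ xy; exists l.
have dL : dir L l \in directions L by apply: imset_f.
exists (dir L l) => //; have pl := partition_directions dL.
have lD : l \in dir L l by rewrite inE lL /parallel eqxx.
by rewrite !(pblock_def pl lD).
Qed.

End AffinePlane.

(** * Transport of directions along a bijection *)

Section Transport.
Variables (P Q : finType) (f : P -> Q).
Hypothesis f_inj : injective f.

Lemma transport_inj : injective (transport f).
Proof. exact: imset_inj (imset_inj f_inj). Qed.

Lemma directions_transport (L : {set {set P}}) :
  directions (transport f L) = [set transport f D | D in directions L].
Proof.
have dirE (l : {set P}) : dir (transport f L) (f @: l) = transport f (dir L l).
  apply/setP => m; rewrite inE; apply/andP/imsetP => [[/imsetP[k kL ->]]|].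
    rewrite /parallel (inj_eq (imset_inj f_inj)) imset_disjoint // => klp.
    by exists k => //; rewrite inE kL.
  case=> k; rewrite inE => /andP[kL klp] ->; split; first exact: imset_f.
  by rewrite /parallel (inj_eq (imset_inj f_inj)) imset_disjoint.
apply/setP => D; apply/imsetP/imsetP => [[_ /imsetP[l lL ->] ->]|[_ /imsetP[l lL ->] ->]].
  by exists (dir L l); rewrite ?imset_f ?dirE.
by exists (f @: l); rewrite ?imset_f ?dirE.
Qed.

Lemma partition_transport D : bijective f -> partition D [set: P] ->
  partition (transport f D) [set: Q].
Proof.
case=> g fK gK pD; have -> : [set: Q] = f @: [set: P].
  by apply/setP => y; rewrite inE -(gK y) imset_f.
by rewrite /transport imset_partition.
Qed.

Lemma pblock_transport D x : bijective f -> partition D [set: P] ->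
  pblock (transport f D) (f x) = f @: pblock D x.
Proof.
move=> fb pD; apply: pblock_def; first exact: partition_transport.
  by rewrite imset_f // pblock_line.
by rewrite imset_f // pblock_refl.
Qed.

Lemma plane_of_directions_transport Ds : bijective f ->
  plane_of_directions Ds -> plane_of_directions [set transport f D | D in Ds].
Proof.
move=> fb [pDs crossDs joinDs]; have [g fK gK] := fb; split.
- by move=> _ /imsetP[D DDs ->]; apply: partition_transport => //; apply: pDs.
- move=> _ _ l' m' /imsetP[D DDs ->] /imsetP[E EDs ->].
  rewrite (inj_eq transport_inj) => DE /imsetP[l lD ->] /imsetP[m mE ->] {l' m'}.
  by rewrite -imsetI; [rewrite card_imset // (crossDs D E) | exact: in2W].
move=> x y; have [D DDs xy] := joinDs (g x) (g y).
exists (transport f D); first exact: imset_f.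
by rewrite -(gK x) -(gK y) !pblock_transport ?xy //; apply: pDs.
Qed.

End Transport.

(** * Counting over the pencil of lines through a point *)

Section Counting.
Variables (P : finType) (Ds : {set {set {set P}}}) (n : nat).
Hypotheses (planeDs : plane_of_directions Ds) (n_gt1 : (1 < n)%N)
  (cardP : #|P| = (n * n)%N)
  (card_line : forall D l, D \in Ds -> l \in D -> #|l| = n).

Let pDs : {in Ds, forall D, partition D [set: P]}. Proof. by case: planeDs. Qed.

Lemma pblock_join_inj x y D E : D \in Ds -> E \in Ds -> D != E ->
  pblock D x = pblock D y -> pblock E x = pblock E y -> x = y.
Proof.
move=> DDs EDs DE xyD xyE; have [_ crossDs _] := planeDs.
have /eqP/cards1P[z Iz] := crossDs _ _ _ _ DDs EDs DE
  (pblock_line x (pDs DDs)) (pblock_line x (pDs EDs)).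
have /set1P-> : x \in [set z] by rewrite -Iz inE !pblock_refl ?pDs.
have /set1P-> // : y \in [set z] by rewrite -Iz inE xyD xyE !pblock_refl ?pDs.
Qed.

Lemma sum_meet_size mu D : D \in Ds ->
  \sum_(l in D) meet_size mu l = \sum_x mu x.
Proof.
move=> DDs; rewrite -(set_partition_big _ (pDs DDs)).
by apply: eq_bigl => x; rewrite inE.
Qed.

(** A line of direction [D] meets each line of direction [E] once, so [pblock E] maps its points
    bijectively onto the lines of [E]. *)
Lemma sum_pblock_transversal (G : {set P} -> int) D E l :
  D \in Ds -> E \in Ds -> D != E -> l \in D ->
  \sum_(x in l) G (pblock E x) = \sum_(m in E) G m.
Proof.
move=> DDs EDs DE lD; have [_ crossDs _] := planeDs.
rewrite (partition_big (pblock E) [in E]) /=; last first.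
  by move=> x _; rewrite pblock_line ?pDs.
apply: eq_bigr => m mE.
have/eqP/cards1P[z Iz] := crossDs _ _ _ _ DDs EDs DE lD mE.
rewrite (eq_bigl (pred1 z)) => [|x].
  rewrite big_pred1_eq; congr G; apply: (pblock_def (pDs EDs)) => //.
  by have := set11 z; rewrite -Iz => /setIP[].
have -> : pred1 z x = (x \in l :&: m) by rewrite Iz !inE.
rewrite inE; congr (_ && _); apply/eqP/idP => [<-|]; first by rewrite pblock_refl ?pDs.
by apply: pblock_def => //; apply: pDs.
Qed.

(** Each point other than [x] is on exactly one line through [x], while [x] is on all of them; the
    extra [mu x] on the left matches its occurrence in the total. *)
Lemma sum_meet_size_pencil mu x :
  \sum_(D in Ds) meet_size mu (pblock D x) + mu x
    = \sum_y mu y + mu x *+ #|Ds|.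
Proof.
have [_ _ joinDs] := planeDs.
rewrite /meet_size (exchange_big_dep predT) //= (bigD1 x) //=.
rewrite (eq_bigl [in Ds]); last first.
  by move=> D /=; apply: andb_idr => DDs; rewrite pblock_refl ?pDs.
rewrite sumr_const [in RHS](bigD1 x) //= -addrA [in LHS]addrC.
congr (_ + _); rewrite addrC; congr (_ + _); apply: eq_bigr => y yx.
have [D DDs xy] := joinDs x y.
rewrite (big_pred1 D) // => E /=; apply/andP/eqP => [[EDs]|->].
  rewrite mem_pblockE ?pDs // => /eqP xyE; apply/eqP; apply: contraNT yx => ED.
  by apply/eqP/esym/(pblock_join_inj EDs DDs ED).
by rewrite mem_pblockE ?pDs // xy eqxx.
Qed.

(** With [N] directions, the pencil identity for the constant [1] reads [N n + 1 = n^2 + N], and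
    [n - 1] can be cancelled. *)
Lemma card_directions : #|Ds| = n.+1.
Proof.
have /card_gt0P[x _] : (0 < #|P|)%N by rewrite cardP; lia.
have := sum_meet_size_pencil [ffun=> 1] x.
rewrite ffunE (eq_bigr (fun=> n%:Z)) => [|D DDs]; last first.
  rewrite /meet_size -(card_line DDs (pblock_line x (pDs DDs))).
  by rewrite (eq_bigr (fun=> 1)) ?sumr_const ?natz // => y; rewrite ffunE.
rewrite sumr_const (eq_bigr (fun=> 1)) => [|y]; last by rewrite ffunE.
rewrite sumr_const cardT -cardE cardP; move: #|Ds| => N; nia.
Qed.

Variables (D1 D2 D3 : {set {set P}}).
Hypotheses (D1Ds : D1 \in Ds) (D2Ds : D2 \in Ds) (D3Ds : D3 \in Ds)
  (D12 : D1 != D2) (D13 : D1 != D3) (D23 : D2 != D3).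

(** There are [n + 1] directions, so the pencil identity isolates [n * mu x]. Conversely, summing
    the identity over a line of a fourth direction turns each of the three terms into the total of
    [mu], which leaves the same value for every line. *)
Lemma equidistributed_outsideP (mu : {ffun P -> int}) :
  {in Ds :\: [set D1; D2; D3], forall D, equidistributed mu D} <->
  exists k : int, forall x,
    mu x *+ n = meet_size mu (pblock D1 x) + meet_size mu (pblock D2 x)
                + meet_size mu (pblock D3 x) + k.
Proof.
split=> [eqmu|[k muE] D]; last first.
  rewrite !inE !negb_or -!andbA => /and4P[DD1 DD2 DD3 DDs].
  suff mE l : l \in D -> meet_size mu l *+ n = (\sum_y mu y) *+ 3 + k *+ n.
    apply/forall_inP => l lD; apply/forall_inP => m mD; apply/eqP.
    have := mE _ mD; rewrite -(mE _ lD) => /eqP.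
    by rewrite eqr_pMn2r ?(ltnW n_gt1) // => /eqP.
  move=> lD; rewrite {1}/meet_size -sumrMnl (eq_bigr _ (fun x _ => muE x)).
  rewrite !big_split /= !(sum_pblock_transversal _ _ _ _ lD) //.
  rewrite !sum_meet_size // sumr_const (card_line DDs lD).
  by rewrite !mulrSr mulr0n add0r.
have /card_gt0P[x0 _] : (0 < #|P|)%N by rewrite cardP; lia.
pose S := Ds :\: [set D1; D2; D3].
(* The constant is what the other directions contribute at any one point, minus the total of
   [mu]. *)
exists (\sum_(D in S) meet_size mu (pblock D x0) - \sum_y mu y) => x.
have := sum_meet_size_pencil mu x; rewrite card_directions mulrSr.
rewrite (big_setID [set D1; D2; D3]) /=.
have -> : Ds :&: [set D1; D2; D3] = [set D1; D2; D3].
  by apply/setIidPr/subsetP => D; rewrite !inE -orbA => /or3P[]/eqP->.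
rewrite -/S.
have -> : \sum_(D in S) meet_size mu (pblock D x)
          = \sum_(D in S) meet_size mu (pblock D x0).
  apply: eq_bigr => D DS; apply/eqP; have DDs : D \in Ds by case/setDP: DS.
  have /forall_inP/(_ _ (pblock_line x (pDs DDs)))/forall_inP := eqmu _ DS.
  by apply; rewrite pblock_line ?pDs.
rewrite -setUA big_setU1 /=; last by rewrite !inE negb_or D12.
rewrite big_setU1 /= ?inE // big_set1.
move: (\sum_(D in S) _) => a; move: (\sum_y _) => b E.
by apply: (addrI (b + mu x)); rewrite -addrA [mu x + _]addrC -E; ring.
Qed.

End Counting.

Lemma exactly_threeP (P : finType) (L : {set {set P}}) (mu : {ffun P -> int})
    D1 D2 D3 :
  D1 \in directions L -> D2 \in directions L -> D3 \in directions L ->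
  inequidistributed_dirs L mu = [set D1; D2; D3] <->
  [/\ ~~ equidistributed mu D1, ~~ equidistributed mu D2,
      ~~ equidistributed mu D3 &
      {in directions L :\: [set D1; D2; D3], forall D, equidistributed mu D}].
Proof.
move=> D1L D2L D3L; split=> [E|[n1 n2 n3 eqmu]].
  have mE D : (D \in inequidistributed_dirs L mu) = (D \in [set D1; D2; D3]).
    by rewrite E.
  have nE D : D \in [set D1; D2; D3] -> ~~ equidistributed mu D.
    by rewrite -mE inE => /andP[].
  split; try by apply: nE; rewrite !inE eqxx ?orbT.
  move=> D /setDP[DL]; rewrite -mE inE DL /=; exact: negbNE.
apply/setP => D; rewrite inE; apply/andP/idP => [[DL]|].
  by apply: contraR => DN; apply: eqmu; rewrite in_setD DL DN.
by rewrite !inE -orbA => /or3P[]/eqP->.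
Qed.

(** * Coordinates in AG(2,q) *)

Section AffineGeometry.
Variable F : finFieldType.
Implicit Types (d e : option F) (v w : 'cV[F]_2) (mu : {ffun 'cV[F]_2 -> int}).

(** The linear form whose level sets are the lines of slope [d]: it is [x], [y], [y - x] for the
    slopes infinity, [0], [1]. *)
Definition intercept d v : F := if d is Some m then v 1 0 - m * v 0 0 else v 0 0.

Lemma AGlineE d b : AGline d b = [set v | intercept d v == b].
Proof. by apply/setP => v; rewrite !inE; case: d => //= m; rewrite subr_eq addrC. Qed.

Lemma mem_AGline d b v : (v \in AGline d b) = (intercept d v == b).
Proof. by rewrite AGlineE inE. Qed.

Lemma interceptB d v w : intercept d (v - w) = intercept d v - intercept d w.
Proof. by case: d => [m|]; rewrite /= !mxE //; ring. Qed.

Lemma interceptZ d a v : intercept d (a *: v) = a * intercept d v.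
Proof. by case: d => [m|]; rewrite /= !mxE //; ring. Qed.

Lemma cV2_eq (v w : 'cV[F]_2) : v 0 0 = w 0 0 -> v 1 0 = w 1 0 -> v = w.
Proof.
move=> E0 E1; apply/colP => -[[|[|//]] lti].
  by rewrite (_ : Ordinal lti = 0) //; apply: val_inj.
by rewrite (_ : Ordinal lti = 1) //; apply: val_inj.
Qed.

Lemma intercept_inj d e v w : d != e ->
  intercept d v = intercept d w -> intercept e v = intercept e w -> v = w.
Proof.
move=> de vwd vwe; have E0 : v 0 0 = w 0 0.
  case: d e de vwd vwe => [m|] [n|] //= mn vwd vwe.
  have mn0 : m - n != 0 by rewrite subr_eq0; apply: contraNneq mn => ->.
  apply: (mulfI mn0); have := congr2 (fun x y => y - x) vwd vwe => E.
  by transitivity ((v 1 0 - n * v 0 0) - (v 1 0 - m * v 0 0)); [|rewrite E]; ring.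
apply: cV2_eq => //; case: d e de vwd vwe => [m|] [n|] //= mn; rewrite E0.
- by move/addIr.
- by move/addIr.
- by move=> _ /addIr.
Qed.

Lemma card_cV2 : #|{: 'cV[F]_2}| = (#|F| * #|F|)%N.
Proof. by rewrite card_mx muln1. Qed.

(** Two such forms give an injective map into [F * F], and both sides have [q^2] elements. *)
Lemma intercept_meet d e b c : d != e -> exists2 v, intercept d v = b & intercept e v = c.
Proof.
move=> de; pose f v : F * F := (intercept d v, intercept e v).
have f_inj : injective f by move=> v w [? ?]; apply: (intercept_inj de).
have [|g _ gK] := inj_card_bij f_inj; first by rewrite card_prod card_cV2.
by exists (g (b, c)); [have := congr1 fst (gK (b, c)) | have := congr1 snd (gK (b, c))].
Qed.

Lemma intercept_surj d b : exists v, intercept d v = b.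
Proof.
case: d => [m|]; first by have [//|v <- _] := @intercept_meet (Some m) None b 0; exists v.
by have [//|v <- _] := @intercept_meet None (Some 0) b 0; exists v.
Qed.

Lemma AGdir_preim d : AGdir d = preim_partition (intercept d) [set: 'cV[F]_2].
Proof.
apply/setP => l; apply/imsetP/imsetP => [[b _ ->]|[v _ ->]].
  have [v vb] := intercept_surj d b; exists v => //.
  by rewrite AGlineE; apply/setP => w; rewrite !inE vb eq_sym.
by exists (intercept d v) => //; rewrite AGlineE; apply/setP => w; rewrite !inE eq_sym.
Qed.

Lemma partition_AGdir d : partition (AGdir d) [set: 'cV[F]_2].
Proof. by rewrite AGdir_preim preim_partitionP. Qed.

Lemma pblock_AGdir d v : pblock (AGdir d) v = AGline d (intercept d v).
Proof.
apply: pblock_def; rewrite ?partition_AGdir ?mem_AGline //; exact: imset_f.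
Qed.

Lemma AGline_inj d : injective (AGline d).
Proof.
move=> b c E; have [v vb] := intercept_surj d b.
by have := mem_AGline d c v; rewrite -E mem_AGline vb eqxx => /esym/eqP.
Qed.

Lemma card_AGline d b : #|AGline d b| = #|F|.
Proof.
have [e de] : exists e, d != e by case: d => [m|]; [exists None|exists (Some 0)].
rewrite -(@card_in_imset _ _ (intercept e)) => [|v w].
  rewrite -cardsT; apply: eq_card => c; rewrite inE; apply/imsetP.
  by have [v vb vc] := intercept_meet b c de; exists v; rewrite // mem_AGline vb.
rewrite !mem_AGline => /eqP vb /eqP wb; apply: (intercept_inj de); exact: etrans vb _.
Qed.

Lemma AGdir_inj : injective (@AGdir F).
Proof.
move=> d e dE; apply/eqP; apply: contraT => de.
have [v vd ve] := intercept_meet 0 0 de; have [w wd we] := intercept_meet 0 1 de.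
have := mem_AGline d (intercept d v) w; rewrite wd vd eqxx -{1}vd -pblock_AGdir dE.
by rewrite pblock_AGdir mem_AGline ve we oner_eq0.
Qed.

Lemma plane_of_directions_AG : plane_of_directions (directions (AG F)).
Proof.
rewrite directions_AG; split.
- by move=> _ /imsetP[d _ ->]; apply: partition_AGdir.
- move=> D E l m /imsetP[d _ ->] /imsetP[e _ ->].
  rewrite (inj_eq AGdir_inj) => de /imsetP[b _ ->] /imsetP[c _ ->].
  have [v vb vc] := intercept_meet b c de.
  apply/eqP/cards1P; exists v; apply/setP => w; rewrite in_setI !mem_AGline in_set1.
  apply/andP/eqP => [[/eqP wb /eqP wc]|->]; last by rewrite vb vc.
  by apply: (intercept_inj de); rewrite ?wb ?wc.
move=> v w.
suff [d vw] : exists d, intercept d v = intercept d w.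
  by exists (AGdir d); [exact: imset_f | rewrite !pblock_AGdir vw].
have [E|nE] := eqVneq (v 0 0) (w 0 0); first by exists None.
exists (Some ((v 1 0 - w 1 0) / (v 0 0 - w 0 0))) => /=; apply/eqP.
have nz : v 0 0 - w 0 0 != 0 by rewrite subr_eq0.
by rewrite -subr_eq0; apply/eqP; field.
Qed.

Lemma meet_sizeE mu d b : meet_size mu (AGline d b) = \sum_(v | intercept d v == b) mu v.
Proof. by apply: eq_bigl => v; rewrite mem_AGline. Qed.

Lemma sum_intercept (u : F -> int) d e b : d != e ->
  \sum_(v | intercept d v == b) u (intercept e v) = \sum_c u c.
Proof.
move=> de; rewrite (partition_big (intercept e) predT) //=; apply: eq_bigr => c _.
have [v vb vc] := intercept_meet b c de; rewrite (big_pred1 v) ?vc // => w /=.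
apply/andP/eqP => [[/eqP wb /eqP wc]|->]; last by rewrite vb vc.
by apply: (intercept_inj de); rewrite ?wb ?wc.
Qed.

Lemma sum_intercept_same (u : F -> int) d b :
  \sum_(v | intercept d v == b) u (intercept d v) = u b *+ #|F|.
Proof.
rewrite (eq_bigr (fun=> u b)) => [|v /eqP-> //].
rewrite sumr_const -(card_AGline d b); congr (_ *+ _).
by apply: eq_card => v; rewrite mem_AGline.
Qed.

Lemma equidistributed_AGP mu d :
  reflect (forall b c, meet_size mu (AGline d b) = meet_size mu (AGline d c))
          (equidistributed mu (AGdir d)).
Proof.
apply: (iffP forall_inP) => [H b c|H _ /imsetP[b _ ->]].
  by apply/eqP; apply: (forall_inP (H _ _)); apply: imset_f.
by apply/forall_inP => _ /imsetP[c _ ->]; apply/eqP.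
Qed.

(** Summed over a line of one of the three slopes, the two other functions give constants and the
    function of that slope gives [q] times its value. Hence each of [A], [B], [C] is a line sum up
    to a constant. *)
Lemma normalize_decomposition mu (A B C : F -> int) k :
  (forall v, mu v *+ #|F| = A (intercept None v) + B (intercept (Some 0) v)
                            + C (intercept (Some 1) v) + k) ->
  exists k', forall v, mu v *+ #|F| =
    meet_size mu (AGline None (intercept None v))
    + meet_size mu (AGline (Some 0) (intercept (Some 0) v))
    + meet_size mu (AGline (Some 1) (intercept (Some 1) v)) + k'.
Proof.
move=> muE; have q0 : (0 < #|F|)%N by apply/card_gt0P; exists 0.
have s10 : Some (1 : F) != Some 0 by apply: contraNneq (oner_neq0 F) => -[->].
have s01 : Some (0 : F) != Some 1 by rewrite eq_sym.
have lineE d b : meet_size mu (AGline d b) *+ #|F| =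
    \sum_(v | intercept d v == b) A (intercept None v)
    + \sum_(v | intercept d v == b) B (intercept (Some 0) v)
    + \sum_(v | intercept d v == b) C (intercept (Some 1) v) + k *+ #|F|.
  rewrite meet_sizeE -sumrMnl (eq_bigr _ (fun v _ => muE v)) !big_split /=.
  congr (_ + _); rewrite sumr_const -(card_AGline d b); congr (_ *+ _).
  by apply: eq_card => v; rewrite mem_AGline.
have EA b : A b = meet_size mu (AGline None b) - (meet_size mu (AGline None 0) - A 0).
  apply: (pmulrnI q0); rewrite !mulrnBl !lineE !sum_intercept_same !sum_intercept //.
  by rewrite /=; ring.
have EB b : B b = meet_size mu (AGline (Some 0) b)
                  - (meet_size mu (AGline (Some 0) 0) - B 0).
  apply: (pmulrnI q0); rewrite !mulrnBl !lineE !sum_intercept_same !sum_intercept //.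
  by rewrite /=; ring.
have EC b : C b = meet_size mu (AGline (Some 1) b)
                  - (meet_size mu (AGline (Some 1) 0) - C 0).
  apply: (pmulrnI q0); rewrite !mulrnBl !lineE !sum_intercept_same !sum_intercept //.
  by rewrite /=; ring.
exists (k - (meet_size mu (AGline None 0) - A 0)
          - (meet_size mu (AGline (Some 0) 0) - B 0)
          - (meet_size mu (AGline (Some 1) 0) - C 0)) => v.
by rewrite muE EA EB EC; ring.
Qed.

End AffineGeometry.

(** * The group of translations in a given direction *)

Section Translations.
Variables (P : finType) (Ds : {set {set {set P}}}) (n : nat).
Hypotheses (planeDs : plane_of_directions Ds) (n_gt1 : (1 < n)%N)
  (cardP : #|P| = (n * n)%N)
  (card_line : forall D l, D \in Ds -> l \in D -> #|l| = n).
Implicit Types (g h : {perm P}) (D E : {set {set P}}).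

Let pDs : {in Ds, forall D, partition D [set: P]}. Proof. by case: planeDs. Qed.

Lemma pblock_meet D E x y : D \in Ds -> E \in Ds -> D != E ->
  exists2 z, pblock D z = pblock D x & pblock E z = pblock E y.
Proof.
move=> DDs EDs DE; have [_ crossDs _] := planeDs.
have /eqP/cards1P[z Iz] := crossDs _ _ _ _ DDs EDs DE
  (pblock_line x (pDs DDs)) (pblock_line y (pDs EDs)).
have := set11 z; rewrite -Iz inE !mem_pblockE ?pDs // => /andP[/eqP zx /eqP zy].
by exists z.
Qed.

Lemma pblock_other D x : D \in Ds -> exists2 y, y != x & pblock D y = pblock D x.
Proof.
move=> DDs; have := card_line DDs (pblock_line x (pDs DDs)).
rewrite (cardsD1 x) pblock_refl ?pDs // => cl.
have /card_gt0P[y] : (0 < #|pblock D x :\ x|)%N by lia.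
by rewrite !inE mem_pblockE ?pDs // => /andP[yx /eqP xy]; exists y.
Qed.

(** A collineation preserving every direction, expressed through the partitions alone; fixed points
    are allowed. *)
Definition dilatation g : bool :=
  [forall E in Ds, forall x, forall y,
     (pblock E x == pblock E y) ==> (pblock E (g x) == pblock E (g y))].

Lemma dilatationP g :
  reflect (forall E x y, E \in Ds -> pblock E x = pblock E y ->
             pblock E (g x) = pblock E (g y)) (dilatation g).
Proof.
apply: (iffP forall_inP) => [H E x y EDs xy|H E EDs].
  by have /forallP/(_ x)/forallP/(_ y) := H E EDs; rewrite xy eqxx => /eqP.
apply/forallP => x; apply/forallP => y; apply/implyP => /eqP xy.
by apply/eqP/H.
Qed.

(** Asking that each line of [D] be mapped to itself makes the group axioms immediate; that a
    nontrivial element has no fixed point is [translation_fix]. *)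
Definition translations D : {set {perm P}} :=
  [set g | dilatation g & [forall x, pblock D (g x) == pblock D x]].

Lemma translationsP D g :
  reflect ((forall E x y, E \in Ds -> pblock E x = pblock E y ->
             pblock E (g x) = pblock E (g y)) /\
           forall x, pblock D (g x) = pblock D x) (g \in translations D).
Proof.
rewrite inE; apply: (iffP andP) => -[/dilatationP dg H]; split=> //.
  by move=> x; apply/eqP; move/forallP: H.
by apply/forallP => x; apply/eqP.
Qed.

Lemma dilatationM g h : dilatation g -> dilatation h -> dilatation (g * h)%g.
Proof.
move=> /dilatationP dg /dilatationP dh; apply/dilatationP => E x y EDs xy.
by rewrite !permM; apply: dh => //; apply: dg.
Qed.

Lemma translations_group_set D : group_set (translations D).
Proof.
apply/group_setP; split=> [|g h].
  by apply/translationsP; split=> [E x y _|x]; rewrite !perm1.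
rewrite !inE => /andP[dg /forallP fg] /andP[dh /forallP fh].
rewrite dilatationM //=; apply/forallP => x.
by rewrite permM (eqP (fh _)) (eqP (fg x)).
Qed.

Canonical translations_group D := Group (translations_group_set D).

(** If [y] is fixed, so is its line to any [z] off the [D]-line of [y]; the [D]-line of [z] is also
    fixed, hence so is [z]. *)
Lemma translation_fix D g x : D \in Ds -> g \in translations D -> g x = x -> g = 1%g.
Proof.
move=> DDs /translationsP[dg fg]; have [_ _ joinDs] := planeDs.
have off y z : g y = y -> pblock D z != pblock D y -> g z = z.
  move=> gy; have [E EDs yz] := joinDs y z => nzy.
  have ED : E != D by apply: contraNneq nzy => <-; rewrite yz.
  apply: (pblock_join_inj planeDs EDs DDs ED); last exact: fg.
  by rewrite -(dg _ _ _ EDs yz) gy.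
move=> gx; apply/permP => y; rewrite perm1.
have [yx|] := eqVneq (pblock D y) (pblock D x); last exact: off.
(* For the points of the [D]-line of [x] itself, a fixed point [z] off that line is found on another
   line through [x], and the argument is repeated from [z]. *)
have [E /setD1P[ED EDs]] : exists E, E \in Ds :\ D.
  apply/set0Pn; rewrite -card_gt0.
  have := card_directions planeDs n_gt1 cardP card_line.
  by rewrite (cardsD1 D Ds) DDs add1n => -[->]; apply: ltnW.
have [z zx zE] := pblock_other x EDs.
have nzx : pblock D z != pblock D x.
  by apply: contraNneq zx => zD; apply/eqP/(pblock_join_inj planeDs EDs DDs ED).
by apply: (off z); [exact: off nzx | rewrite yx eq_sym].
Qed.

(** If some [z] moved in a direction [E] other than [D], the [E]-line of [z] and the [D]-line of [x]
    would both be invariant, and their meeting point fixed. *)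
Lemma dilatation_translations D g x : D \in Ds -> dilatation g ->
  (forall y, g y != y) -> pblock D (g x) = pblock D x -> g \in translations D.
Proof.
move=> DDs /dilatationP dg fpf gx; apply/translationsP; split=> // z.
have [_ _ joinDs] := planeDs; have [E EDs gz] := joinDs (g z) z.
have [<- //|ED] := eqVneq E D; have [w wz wx] := pblock_meet z x EDs DDs ED.
case/eqP: (fpf w); apply: (pblock_join_inj planeDs EDs DDs ED).
  by rewrite (dg _ _ _ EDs wz) gz.
by rewrite (dg _ _ _ DDs wx) gx.
Qed.

(** Either product sends [x] to the point where the [D]-line of [h x] meets the [E]-line of
    [g x]. *)
Lemma translations_commute D E g h : D \in Ds -> E \in Ds -> D != E ->
  g \in translations D -> h \in translations E -> commute g h.
Proof.
move=> DDs EDs DE /translationsP[dg fg] /translationsP[dh fh].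
apply/permP => x; rewrite !permM; apply: (pblock_join_inj planeDs DDs EDs DE).
  by rewrite fg; apply: dh.
by rewrite fh; apply: dg.
Qed.

Lemma translations_meet D E g : D \in Ds -> E \in Ds -> D != E ->
  g \in translations D -> g \in translations E -> g = 1%g.
Proof.
move=> DDs EDs DE /translationsP[_ gD] /translationsP[_ gE].
by apply/permP => x; rewrite perm1; apply: (pblock_join_inj planeDs DDs EDs DE).
Qed.

(** A point [y] fixed by the product would have [g y] on both its [D]-line and its [E]-line, so [g]
    would fix [y]. The product is thus a translation in some direction, and if this were [D] or [E],
    one factor would lie in both groups. *)
Lemma translationsM D E g h : D \in Ds -> E \in Ds -> D != E ->
  g \in translations D -> h \in translations E -> g != 1%g -> h != 1%g ->
  exists D', [/\ D' \in Ds, D' != D, D' != E & (g * h)%g \in translations D'].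
Proof.
move=> DDs EDs DE gD hE g1 h1.
have [dg fg] := translationsP _ _ gD; have [dh fh] := translationsP _ _ hE.
have /card_gt0P[x _] : (0 < #|P|)%N by rewrite cardP; lia.
have fpf y : (g * h)%g y != y.
  apply: contra g1 => /eqP; rewrite permM => ghy; apply/eqP.
  apply: (translation_fix DDs gD (x := y)).
  by apply: (pblock_join_inj planeDs DDs EDs DE); rewrite // -(fh (g y)) ghy.
have [_ _ joinDs] := planeDs; have [D' D'Ds xy] := joinDs ((g * h)%g x) x.
have dgh : dilatation (g * h)%g by apply: dilatationM; apply/dilatationP.
have ghD' := dilatation_translations D'Ds dgh fpf xy.
exists D'; split=> //.
  apply: contra h1 => /eqP D'D; rewrite D'D in ghD'; apply/eqP.
  apply: (translations_meet DDs EDs DE) => //.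
  by rewrite -(groupMl h gD).
apply: contra g1 => /eqP D'E; rewrite D'E in ghD'; apply/eqP.
apply: (translations_meet DDs EDs DE) => //.
by rewrite -(groupMr g hE).
Qed.

Hypothesis trans : forall x y : P, exists g : {perm P},
  [/\ dilatation g, g = 1%g \/ (forall z, g z != z) & g x = y].

Lemma translations_transitive D x y : D \in Ds -> pblock D y = pblock D x ->
  exists2 g, g \in translations D & g x = y.
Proof.
move=> DDs yx; have [g [dg [g1|fpf] gxy]] := trans x y.
  by exists g; rewrite // g1; apply: (group1 (translations_group D)).
by exists g => //; apply: (dilatation_translations (x := x)); rewrite // gxy.
Qed.

(** The group acts simply transitively on each line of direction [D]. *)
Lemma card_translations D : D \in Ds -> #|translations D| = n.
Proof.
move=> DDs; have /card_gt0P[x _] : (0 < #|P|)%N by rewrite cardP; lia.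
rewrite -(card_line DDs (pblock_line x (pDs DDs))).
rewrite -(@card_in_imset _ _ (fun g : {perm P} => g x)) => [|g h gD hD gh].
  apply: eq_card => y; rewrite mem_pblockE ?pDs //; apply/imsetP/eqP => [|xy].
    by case=> g /translationsP[_ fg] ->; rewrite fg.
  by have [g gD <-] := translations_transitive DDs (esym xy); exists g.
apply/eqP; rewrite eq_mulVg1; apply/eqP/(translation_fix DDs (x := h x)).
  by rewrite (groupMr _ hD) groupV.
by rewrite permM -gh permK.
Qed.

(** Write [g'] as [(g' h) h^-1] with [h] a nontrivial translation in another direction: both factors
    have directions other than [D], so they commute with [g]. *)
Lemma translations_abelian D E : D \in Ds -> E \in Ds -> D != E ->
  abelian (translations D).
Proof.
move=> DDs EDs DE.
have [h hE h1] : exists2 h, h \in translations E & h != 1%g.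
  apply/(trivgPn (translations_group E)).
  by rewrite -cardG_gt1 /= card_translations.
apply/centsP => g gD g' g'D.
have [->|g'1] := eqVneq g' 1%g; first by rewrite /commute mulg1 mul1g.
have [D' [D'Ds D'D _ g'hD']] := translationsM DDs EDs DE g'D hE g'1 h1.
have gh : commute g h := translations_commute DDs EDs DE gD hE.
rewrite -[g'](mulgK h); apply: commuteM; last exact: commuteV.
by apply: (translations_commute DDs D'Ds) => //; rewrite eq_sym.
Qed.

(** Cauchy gives [h] of order [p] in another direction. Then [(g h)^p = g^p] is a translation both
    in direction [D] and in the direction of [g h], hence trivial. *)
Lemma translations_abelem p D E : prime p -> (p %| n)%N ->
  D \in Ds -> E \in Ds -> D != E -> (p.-abelem (translations D))%g.
Proof.
move=> p_pr pn DDs EDs DE.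
have [h hE oh] : {h | h \in translations E & #[h]%g = p}.
  by apply: (Cauchy (G := translations_group E)); rewrite ?card_translations.
have h1 : h != 1%g by rewrite -order_gt1 oh prime_gt1.
apply/abelemP => //; split; first exact: translations_abelian EDs DE.
move=> g gD; have [->|g1] := eqVneq g 1%g; first exact: expg1n.
have [D' [D'Ds D'D _ ghD']] := translationsM DDs EDs DE gD hE g1 h1.
have gh : commute g h := translations_commute DDs EDs DE gD hE.
apply: (translations_meet D'Ds DDs D'D); last by apply: (groupX (G := translations_group D)).
have := groupX (G := translations_group D') p ghD'.
by rewrite expgMn // -oh expg_order mulg1.
Qed.

End Translations.

(** * Existence of the representation *)

Lemma transport_AGdir (F : finFieldType) (P : finType) (D : {set {set P}})
    (f : P -> 'cV[F]_2) d : bijective f -> partition D [set: P] ->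
  {in D, forall l : {set P}, #|l| = #|F|} ->
  (forall x y, pblock D x = pblock D y -> intercept d (f x) = intercept d (f y)) ->
  transport f D = AGdir d.
Proof.
move=> [g fK gK] pD card_line interceptE.
have lineE x : f @: pblock D x = AGline d (intercept d (f x)).
  apply/eqP; rewrite eqEcard card_imset ?card_line ?pblock_line ?card_AGline //=;
    last exact: can_inj fK.
  rewrite leqnn andbT; apply/subsetP => _ /imsetP[y xy ->]; rewrite mem_AGline.
  by move: xy; rewrite mem_pblockE // => /eqP/interceptE->.
apply/setP => l; apply/imsetP/imsetP => [[m mD ->]|[b _ ->]].
  have /card_gt0P[x xm] : (0 < #|m|)%N by rewrite card_line //; apply/card_gt0P; exists 0.
  by exists (intercept d (f x)); rewrite // -lineE (pblock_def pD mD xm).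
have [v <-] := intercept_surj d b.
by exists (pblock D (g v)); rewrite ?pblock_line // lineE gK.
Qed.

Lemma abelem_finField (F : finFieldType) p h : prime p -> #|F| = (p ^ h)%N ->
  (p.-abelem [set: F])%g.
Proof.
move=> p_pr cardF; apply/abelemP => //; split=> [|x _].
  by apply/centsP => x _ y _; apply: addrC.
by rewrite FinRing.zmodXgE -mulr_natr (pcharf0 (card_finPcharP cardF p_pr)) mulr0.
Qed.

(** The coordinates of a point are read along its lines of directions [D1] and [D2] on the [D3]-line
    of an origin [O]. A translation in direction [D3] adds the same amount to both, so the
    [D3]-lines become the level sets of [y - x]. *)
Lemma exists_representation (p h : nat) (F : finFieldType) (P : finType)
    (Ds : {set {set {set P}}}) D1 D2 D3 :
  prime p -> #|F| = (p ^ h)%N -> plane_of_directions Ds ->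
  #|P| = (#|F| * #|F|)%N ->
  (forall D l, D \in Ds -> l \in D -> #|l| = #|F|) ->
  (forall x y : P, exists g : {perm P},
    [/\ dilatation Ds g, g = 1%g \/ (forall z, g z != z) & g x = y]) ->
  D1 \in Ds -> D2 \in Ds -> D3 \in Ds -> D1 != D2 -> D1 != D3 -> D2 != D3 ->
  exists f : P -> 'cV[F]_2,
    [/\ bijective f, transport f D1 = AGdir None,
        transport f D2 = AGdir (Some 0) & transport f D3 = AGdir (Some 1)].
Proof.
move=> p_pr cardF planeDs cardP card_line trans D1Ds D2Ds D3Ds D12 D13 D23.
have q_gt1 : (1 < #|F|)%N := finNzRing_gt1 F.
have pDs : {in Ds, forall D, partition D [set: P]} by case: planeDs.
have p_q : (p %| #|F|)%N.
  by case: h cardF q_gt1 => [->//|h] -> _; rewrite expnS dvdn_mulr.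
have cardT D := card_translations planeDs q_gt1 cardP card_line trans (D := D).
have abT : (p.-abelem (translations Ds D3))%g.
  apply: (translations_abelem planeDs q_gt1 cardP card_line trans p_pr p_q D3Ds D1Ds).
  by rewrite eq_sym.
(* Both groups are elementary abelian of order [q], hence isomorphic; [chi] labels the translations
   by the elements of [F]. *)
have /isogP[chi inj_chi im_chi] : ([set: F] \isog translations_group Ds D3)%g.
  by rewrite (isog_abelem_card _ (abelem_finField p_pr cardF)) abT /= cardT ?cardsT.
have chiT x : chi x \in translations Ds D3.
  by rewrite -[translations Ds D3]/(gval (translations_group Ds D3)) -im_chi mem_morphim ?inE.
have chiD x y z : chi (x + y) z = chi x (chi y z).
  by rewrite addrC -FinRing.zmodMgE morphM ?inE // permM.
have chi_pblock E x y z : E \in Ds -> pblock E y = pblock E z ->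
    pblock E (chi x y) = pblock E (chi x z).
  by have /translationsP[d _] := chiT x; apply: d.
have chi_fix x z : pblock D3 (chi x z) = pblock D3 z.
  by have /translationsP[] := chiT x.
have chi_trans y z : pblock D3 y = pblock D3 z -> exists x, y = chi x z.
  move=> yz; have [g gT <-] := translations_transitive planeDs trans D3Ds yz.
  have : g \in (chi @* [set: F])%g by rewrite im_chi.
  by case/morphimP => x _ _ ->; exists x.
have /card_gt0P[O _] : (0 < #|P|)%N by rewrite cardP muln_gt0 ltnW.
have chi_inj x y : chi x O = chi y O -> x = y.
  move=> xy; apply: (injmP inj_chi); rewrite ?inE //.
  apply/eqP; rewrite eq_mulVg1.
  apply/eqP/(translation_fix planeDs q_gt1 cardP card_line D3Ds (x := chi x O)).
    by rewrite (groupMl (G := translations_group Ds D3)) ?(groupV (translations_group Ds D3)) ?chiT.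
  by rewrite permM permK xy.
(* The label of the point where the [D]-line of [z] crosses the [D3]-line of [O]; for [D] other than
   [D3] it exists, so the default is not taken. *)
pose X D z := odflt 0 [pick x | pblock D (chi x O) == pblock D z].
have XP D z : D \in Ds -> D != D3 -> pblock D (chi (X D z) O) = pblock D z.
  move=> DDs DD3; rewrite /X; case: pickP => [x /eqP //|noX].
  have [w wz wO] := pblock_meet planeDs z O DDs D3Ds DD3.
  by have [x wx] := chi_trans w O wO; have := noX x; rewrite -wx wz eqxx.
have X_unique D x z : D \in Ds -> D != D3 ->
    pblock D (chi x O) = pblock D z -> X D z = x.
  move=> DDs DD3 xz; apply: chi_inj.
  apply: (pblock_join_inj planeDs DDs D3Ds DD3); last by rewrite !chi_fix.
  exact: etrans (XP _ _ DDs DD3) (esym xz).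
have XD D t z : D \in Ds -> D != D3 -> X D (chi t z) = t + X D z.
  move=> DDs DD3; apply: X_unique => //; rewrite chiD.
  by apply: chi_pblock => //; apply: XP.
pose f z : 'cV[F]_2 := \col_i (if i == 0 then X D1 z else X D2 z).
have fN z : intercept None (f z) = X D1 z by rewrite /= mxE.
have f0 z : intercept (Some 0) (f z) = X D2 z by rewrite /= !mxE mul0r subr0.
have f1 z : intercept (Some 1) (f z) = X D2 z - X D1 z by rewrite /= !mxE mul1r.
have f_bij : bijective f.
  apply: inj_card_bij; last by rewrite card_cV2 cardP.
  move=> y z yz; apply: (pblock_join_inj planeDs D1Ds D2Ds D12).
    by rewrite -(XP D1 y D1Ds D13) -(XP D1 z D1Ds D13) -!fN yz.
  by rewrite -(XP D2 y D2Ds D23) -(XP D2 z D2Ds D23) -!f0 yz.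
exists f; split=> //; apply: transport_AGdir => //; try exact: pDs; try by move=> l; exact: card_line.
- by move=> y z yz; rewrite !fN; apply: X_unique => //; rewrite yz; apply: XP.
- by move=> y z yz; rewrite !f0; apply: X_unique => //; rewrite yz; apply: XP.
- move=> y z /chi_trans[t ->]; rewrite !f1 !XD //; ring.
Qed.

Lemma translation_dilatation (P : finType) (L : {set {set P}}) (g : {perm P}) :
  affine_plane L -> set0 \notin L -> translation L g ->
  dilatation (directions L) g /\ (g = 1%g \/ forall z, g z != z).
Proof.
move=> affL L_n0 [->|[cg pg fpf]].
  by split; [apply/dilatationP => E x y _; rewrite !perm1 | left].
split; last by right.
apply/dilatationP => E x y EL xy; have pE := partition_directions affL L_n0 EL.
have lE := pblock_line x pE; have [lL El] := mem_directions affL EL lE.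
have gE : g @: pblock E x \in E by rewrite {2}El inE cg lL pg.
rewrite (pblock_def (x := g x) pE gE); last by rewrite imset_f ?pblock_refl.
by rewrite (pblock_def (x := g y) pE gE) // imset_f // xy pblock_refl.
Qed.

(** The lines of [E] partition the points into blocks of size [n], and a line of [D], with its [n]
    points, meets each block once. *)
Lemma card_affine_plane (P : finType) (Ds : {set {set {set P}}}) n D E :
  plane_of_directions Ds -> (forall D l, D \in Ds -> l \in D -> #|l| = n) ->
  (0 < n)%N -> D \in Ds -> E \in Ds -> D != E -> #|P| = (n * n)%N.
Proof.
move=> planeDs card_line n_gt0 DDs EDs DE; have [pDs _ _] := planeDs.
rewrite -cardsT (card_uniform_partition (fun l => card_line E l EDs) (pDs _ EDs)).
congr (_ * _)%N; have [l lD] : exists l, l \in D.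
  have [D0|[l lD]] := set_0Vmem D; last by exists l.
  have /cover_partition := pDs _ DDs; rewrite D0 /cover big_set0 => T0.
  have [E0|[m mE]] := set_0Vmem E; first by rewrite D0 E0 eqxx in DE.
  have : (0 < #|m|)%N by rewrite (card_line _ _ EDs mE).
  by case/card_gt0P => x _; have := in_setT x; rewrite -T0 inE.
have := sum_pblock_transversal planeDs (fun=> 1) DDs EDs DE lD.
by rewrite !sumr_const (card_line _ _ DDs lD) => /eqP; rewrite eqr_nat => /eqP.
Qed.

(** * Integer representatives of residues modulo p *)

Section PrimeField.
Variable p : nat.
Hypothesis p_pr : prime p.

Lemma ltn_Fp (c : 'F_p) : (c < p)%N.
Proof. by have := ltn_ord c; rewrite [X in (_ < X)%N -> _]Fp_cast. Qed.

Lemma val_Fp_int (m : int) : ((m%:~R : 'F_p) : nat)%:Z = (m %% p)%Z.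
Proof.
have p_gt0 : 0 < p%:Z by rewrite ltz_nat prime_gt0.
rewrite [in LHS](divz_eq m p) intrD intrM -pmulrn pchar_Fp_0 // mulr0 add0r.
have := modz_ge0 m (lt0r_neq0 p_gt0); have := ltz_pmod m p_gt0.
case: (m %% p)%Z => // r; rewrite ltz_nat => rp _.
by rewrite -pmulrn val_Fp_nat // modn_small.
Qed.

Lemma Fp_intK (c : 'F_p) : (c : nat)%:~R = c.
Proof. exact: natr_Zp. Qed.

(** The representative of [c - d] is the integer difference, increased by [p] exactly when a borrow
    occurs, that is, when [c < d]. *)
Lemma ltn_FpE (c d : 'F_p) : ((c < d)%N : nat)%:Z * p =
  (d : nat)%:Z - (c : nat)%:Z + (nat_of_ord ((c - d)%R : 'F_p))%:Z.
Proof.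
have cp := ltn_Fp c; have dp := ltn_Fp d.
rewrite -[in (c - d)](Fp_intK c) -[in (_ - d)](Fp_intK d) -intrB val_Fp_int.
have [cd|dc] := ltnP c d.
  by rewrite -modzDr modz_small; lia.
by rewrite modz_small; lia.
Qed.

End PrimeField.

(** * The trace and the additive forms on F *)

Section Trace.
Variables (p h : nat) (F : finFieldType).
Hypotheses (p_pr : prime p) (cardF : #|F| = (p ^ h)%N).

Let pF : p \in [pchar F] := card_finPcharP cardF p_pr.

Lemma natr_Fp_inj (c d : 'F_p) : (c : nat)%:R = (d : nat)%:R :> F -> c = d.
Proof.
wlog cd : c d / (c <= d)%N => [W E|].
  by case/orP: (leq_total c d) => [/W->|/W->].
move/esym/eqP; rewrite -subr_eq0 -natrB // -(dvdn_pcharf pF) => pcd.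
apply/val_inj/eqP; rewrite /= eqn_leq cd /= -subn_eq0.
have: (d - c < p)%N by apply: leq_ltn_trans (ltn_Fp p_pr d); exact: leq_subr.
by move/modn_small => <-.
Qed.

Lemma natr_FpD (c d : 'F_p) : (nat_of_ord ((c + d)%R : 'F_p))%:R = (c : nat)%:R + (d : nat)%:R :> F.
Proof.
have -> : c + d = (c + d)%N%:R :> 'F_p by rewrite natrD !natr_Zp.
by rewrite val_Fp_nat // (GRing.natr_mod_pchar pF) natrD.
Qed.

Lemma absTrD (x y : F) : absTr p (x + y) = absTr p x + absTr p y.
Proof.
apply: natr_Fp_inj; rewrite natr_FpD !(absTrP _ p_pr cardF) -big_split /=.
apply: eq_bigr => i _; rewrite exprDn_pchar //; first by rewrite pnatX pnatE // pF.
Qed.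

(** The trace is a polynomial of degree [p^(h-1)], too small for all [q] elements of [F] to be
    roots. *)
Lemma absTr_neq0 : exists x : F, absTr p x != 0.
Proof.
have h_gt0 : (0 < h)%N.
  by case: h cardF => // /eqP; rewrite eqn_leq leqNgt finNzRing_gt1.
pose T : {poly F} := \sum_(i < h) 'X^(p ^ i).
have szT : size T = (p ^ h.-1).+1.
  rewrite /T -(prednK h_gt0) big_ord_recr /= addrC size_polyDl size_polyXn //.
  rewrite ltnS (leq_trans (size_sum _ _ _)) //; apply/bigmax_leqP => i _.
  by rewrite size_polyXn ltn_exp2l ?prime_gt1.
case: (pickP (fun x : F => absTr p x != 0)) => [x nz|Tr0]; first by exists x.
have T0 : T != 0 by rewrite -size_poly_eq0 szT.
have: all (root T) (enum F).
  apply/allP => x _; rewrite /root /T horner_sum; apply/eqP.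
  under eq_bigr do rewrite hornerXn.
  by rewrite -(absTrP x p_pr cardF) (eqP (negbFE (Tr0 x))).
move/(max_poly_roots T0)/(_ (enum_uniq F)); rewrite -cardE cardF szT ltnS leqNgt.
by rewrite ltn_exp2l ?prime_gt1 ?ltn_predL ?h_gt0.
Qed.

Definition Fp_forms : {set {ffun F -> 'F_p}} :=
  [set f : {ffun F -> 'F_p} | [forall x, forall y, f (x + y) == f x + f y]].

Lemma Fp_formsP (f : {ffun F -> 'F_p}) :
  reflect (forall x y, f (x + y) = f x + f y) (f \in Fp_forms).
Proof.
rewrite inE; apply: (iffP forallP) => H x; last by apply/forallP => y; apply/eqP.
by move=> y; apply/eqP; apply: (forallP (H x)).
Qed.

Lemma card_Fp_forms : (#|Fp_forms| <= #|F|)%N.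
Proof.
have abF := abelem_finField p_pr cardF.
have [B genB cardB] := grank_witness [set: F]%G.
have oB : #|B| = h.
  by rewrite cardB grank_abelian ?(abelem_abelian abF) // (rank_abelem abF) cardsT cardF pfactorK.
pose r (f : {ffun F -> 'F_p}) : {ffun 'I_#|B| -> 'F_p} := [ffun i => f (enum_val i)].
suff r_inj : {in Fp_forms &, injective r}.
  rewrite -(card_in_imset r_inj) (leq_trans (max_card _)) //.
  by rewrite card_ffun card_Fp // card_ord oB cardF.
move=> f g /Fp_formsP fD /Fp_formsP gD fg.
have f0 : f 0 = 0 by apply: (addrI (f 0)); rewrite -fD !addr0.
have g0 : g 0 = 0 by apply: (addrI (g 0)); rewrite -gD !addr0.
(* Two forms agree on a subgroup; once it contains the generators [B], it is everything. *)
pose E := [set x | f x == g x].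
have gE : group_set E.
  apply/group_setP; split=> [|x y]; rewrite !inE ?f0 ?g0 // => /eqP Ex /eqP Ey.
  by rewrite FinRing.zmodMgE fD gD Ex Ey.
have sBE : B \subset E.
  apply/subsetP => x Bx; rewrite inE; have := congr1 (fun u : {ffun _} => u (enum_rank_in Bx x)) fg.
  by rewrite !ffunE enum_rankK_in // => ->.
have : (<<B>> \subset Group gE)%g by rewrite gen_subG.
rewrite genB => /subsetP sFE; apply/ffunP => x; apply/eqP.
by have := sFE x (in_setT x); rewrite inE.
Qed.

(* By counting: the [q] forms [x |-> Tr (a x)] are distinct, and a form is
   determined by its values on [h] generators of [F]. *)
Lemma absTr_dual (f : F -> 'F_p) : (forall x y, f (x + y) = f x + f y) ->
  exists a, forall x, f x = absTr p (a * x).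
Proof.
move=> fD; pose t (a : F) : {ffun F -> 'F_p} := [ffun x => absTr p (a * x)].
have t_inj : injective t.
  move=> a b ab; apply/eqP; rewrite -subr_eq0; apply: contraT => nz.
  (* An element of nonzero trace, written [(a - b) y], separates the two forms at [y]. *)
  have [x] := absTr_neq0; rewrite -[x](divfK nz) mulrC mulrBl -[absTr _ _]addr0.
  set y := x / _; have /ffunP/(_ y) := ab; rewrite !ffunE => E.
  have : absTr p (a * y - b * y) + absTr p (b * y) = absTr p (b * y).
    by rewrite -absTrD subrK.
  by rewrite -[RHS]add0r => /addIr->; rewrite addr0 eqxx.
have tF : t @: F = Fp_forms.
  apply/eqP; rewrite eqEcard (card_imset _ t_inj) card_Fp_forms andbT.
  apply/subsetP => _ /imsetP[a _ ->]; apply/Fp_formsP => x y.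
  by rewrite !ffunE mulrDr absTrD.
have : [ffun x => f x] \in Fp_forms by apply/Fp_formsP => x y; rewrite !ffunE.
by rewrite -tF => /imsetP[a _ /ffunP E]; exists a => x; have := E x; rewrite !ffunE.
Qed.

End Trace.

(** * Solving the congruence modulo q *)

Section Decomposition.
Variables (p h : nat) (F : finFieldType).
Hypotheses (p_pr : prime p) (cardF : #|F| = (p ^ h)%N).

Let q_gt1 : (1 < #|F|)%N := finNzRing_gt1 F.

Lemma card_F_factor : #|F| = (#|F| %/ p * p)%N.
Proof.
by rewrite divnK // cardF; case: h cardF q_gt1 => [->//|h'] _ _; rewrite expnS dvdn_mulr.
Qed.

(* Modulo [q] the function [C] is affine, hence, [F] having exponent [p], equal
   to its value at [0] plus [q / p] times a form with values in ['F_p]. *)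
Lemma linear_mod_q (A B C : F -> int) (k : int) :
  (forall x y, (#|F| %| A x + B y + C (y - x) + k)%Z) ->
  exists a, forall x,
    [/\ (#|F| %| A x - A 0%R + (#|F| %/ p)%N%:Z * (absTr p (a * x) : nat)%:Z)%Z,
        (#|F| %| B x - B 0%R - (#|F| %/ p)%N%:Z * (absTr p (a * x) : nat)%:Z)%Z &
        (#|F| %| C x - C 0%R - (#|F| %/ p)%N%:Z * (absTr p (- (a * x)) : nat)%:Z)%Z].
Proof.
move=> H; set q := #|F| in H *; set e := (#|F| %/ p)%N.
have qE : q%:Z = p%:Z * e%:Z by rewrite /q card_F_factor -/e PoszM mulrC.
have p_gt0 : 0 < p%:Z by rewrite ltz_nat prime_gt0.
have e_gt0 : 0 < e%:Z by rewrite ltz_nat; case: e qE => //; rewrite mulr0 /q; lia.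
pose c t := C (- t) - C 0.
(* A second difference of the hypothesis eliminates [A], [B] and [k]. *)
have CB x y : (q %| C (y - x) - C y + C x - C 0%R)%Z.
  have -> : C (y - x) - C y + C x - C 0 =
    (A x + B y + C (y - x) + k) - (A 0 + B y + C (y - 0) + k)
    - ((A x + B x + C (x - x) + k) - (A 0 + B x + C (x - 0) + k)).
    by rewrite !subr0 subrr; ring.
  by rewrite !rpredB.
have cD s t : (q %| c (s + t) - c s - c t)%Z.
  have := rpredB (CB t (- s)) (CB t 0).
  rewrite -opprD /c sub0r.
  by congr (_ %| _)%Z; ring.
have cM t m : (q %| c (t *+ m) - c t *+ m)%Z.
  elim: m => [|m IH]; first by rewrite !mulr0n /c oppr0 subrr.
  have := rpredD (cD (t *+ m) t) IH; congr (_ %| _)%Z.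
  by rewrite -mulrSr mulrSr [c t *+ m.+1]mulrSr; ring.
(* Since [p t = 0] in [F], additivity gives [q | p * c t], that is, [e | c t]. *)
have ce t : (e %| c t)%Z.
  have := cM t p; rewrite (mulrn_pchar (card_finPcharP cardF p_pr)).
  rewrite {1}/c oppr0 subrr sub0r rpredN qE -mulr_natl natz dvdz_mul2l //.
  exact: lt0r_neq0.
pose f t : 'F_p := (c t %/ e)%Z%:~R.
have fE t : (q %| c t - e%:Z * (f t : nat)%:Z)%Z.
  rewrite val_Fp_int //; have := divzK (ce t); move: (c t %/ e)%Z => m <-.
  by rewrite [m * _]mulrC -mulrBr qE mulrC dvdz_mul // {1}(divz_eq m p) addrK dvdz_mull.
have fD s t : f (s + t) = f s + f t.
  have /dvdzP[m mE] : (p %| (c (s + t)%R %/ e)%Z - (c s %/ e)%Z - (c t %/ e)%Z)%Z.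
    rewrite -(@dvdz_mul2r e) ?lt0r_neq0 // -qE !mulrBl !divzK //.
  apply/eqP; rewrite -subr_eq0 opprD addrA /f -!intrB mE intrM -pmulrn.
  by rewrite pchar_Fp_0 ?mulr0.
have [a aE] := absTr_dual p_pr cardF fD.
exists a => x; rewrite -(mulrN a) -!aE; split.
- have := rpredB (rpredB (H x 0) (H 0 0)) (fE x); congr (_ %| _)%Z.
  by rewrite /c !sub0r oppr0; ring.
- have := rpredD (rpredD (rpredB (H 0 x) (H 0 0)) (cD x (- x))) (fE x).
  by congr (_ %| _)%Z; rewrite (subrr x) /c !subr0 !opprK !oppr0; ring.
- by have := fE (- x); rewrite /c opprK.
Qed.

End Decomposition.

(** * Integral decomposition by the lift and the three directions *)

Section ThreeDirections.
Variables (p h : nat) (F : finFieldType).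
Hypotheses (p_pr : prime p) (cardF : #|F| = (p ^ h)%N).
Implicit Types (v w : 'cV[F]_2) (mu : {ffun 'cV[F]_2 -> int}).

Let q_gt1 : (1 < #|F|)%N := finNzRing_gt1 F.
Let q_gt0 : 0 < #|F|%:Z. Proof. by rewrite ltz_nat; apply: ltnW. Qed.
Let qE : #|F|%:Z = (#|F| %/ p)%N%:Z * p%:Z.
Proof. by rewrite {1}(card_F_factor cardF) PoszM. Qed.

Lemma absTr0 : absTr p (0 : F) = 0.
Proof. by apply: (addrI (absTr p (0 : F))); rewrite -(absTrD p_pr cardF) !addr0. Qed.

Lemma absTrN (x : F) : absTr p (- x) = - absTr p x.
Proof. by apply: (addrI (absTr p x)); rewrite -(absTrD p_pr cardF) !subrr absTr0. Qed.

Lemma absTrB (x y : F) : absTr p (x - y) = absTr p x - absTr p y.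
Proof. by rewrite (absTrD p_pr cardF) absTrN. Qed.

Lemma absTr_surj (a : F) (c : 'F_p) : a != 0 -> exists x, absTr p (a * x) = c.
Proof.
move=> a0; have [x x0] := absTr_neq0 p_pr cardF.
have TrM m : absTr p (x *+ m) = absTr p x *+ m.
  by elim: m => [|m IH]; rewrite ?absTr0 // !mulrSr (absTrD p_pr cardF) IH.
exists (a^-1 * (x *+ (c / absTr p x)%R)).
by rewrite mulVKf // TrM -mulr_natr natr_Zp mulrC divfK.
Qed.

Lemma intercept1 v : intercept (Some 1) v = intercept (Some 0) v - intercept None v.
Proof. by rewrite /=; ring. Qed.

(** For nonzero [a], the preimage of the lift of [K] under the homothety of ratio [a]; empty for
    [a = 0]. *)
Definition below (a : F) v : bool :=
  (absTr p (a * intercept None v)%R < absTr p (a * intercept (Some 0) v)%R)%N.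

Lemma mem_Lift v : (v \in Lift F (Kset p)) = below 1 v.
Proof. by rewrite !inE !mxE /below /= !mul1r mul0r subr0. Qed.

Lemma linear_mod_q_plane mu (A B C : F -> int) k :
  (forall v, mu v *+ #|F| = A (intercept None v) + B (intercept (Some 0) v)
                            + C (intercept (Some 1) v) + k) ->
  forall x y, (#|F| %| A x + B y + C (y - x) + k)%Z.
Proof.
move=> muE x y; have [//|v vx vy] := @intercept_meet F None (Some 0) x y.
rewrite -vx -vy -intercept1 -muE -mulr_natr natz; exact: dvdz_mull.
Qed.

(** Dividing [A], [B], [C] by [q] leaves remainders that are multiples of [e = q / p]; by the carry
    identity they add up to [q] times the indicator of [below a]. *)
Lemma lift_decomposition mu (A B C : F -> int) k :
  (forall v, mu v *+ #|F| = A (intercept None v) + B (intercept (Some 0) v)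
                            + C (intercept (Some 1) v) + k) ->
  exists a (A' B' C' : F -> int), forall v,
    mu v = (below a v)%:R + (A' (intercept None v) + B' (intercept (Some 0) v)
                             + C' (intercept (Some 1) v)).
Proof.
move=> muE; have [a aE] := linear_mod_q p_pr cardF (linear_mod_q_plane muE).
pose e := (#|F| %/ p)%N%:Z; pose q := #|F|%:Z.
pose A' x := ((A x - A 0 + e * (absTr p (a * x) : nat)%:Z)%R %/ q)%Z.
pose B' x := ((B x - B 0 - e * (absTr p (a * x) : nat)%:Z)%R %/ q)%Z.
pose C' x := ((C x - C 0 - e * (absTr p (- (a * x)) : nat)%:Z)%R %/ q)%Z.
pose G v := A' (intercept None v) + B' (intercept (Some 0) v) + C' (intercept (Some 1) v).
have GE v : mu v * q = ((below a v)%:R + G v) * q + (A 0 + B 0 + C 0 + k).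
  have [A_dv _ _] := aE (intercept None v).
  have [_ B_dv _] := aE (intercept (Some 0) v).
  have [_ _ C_dv] := aE (intercept (Some 1) v).
  have below_q : (below a v)%:R * q = e * ((absTr p (a * intercept (Some 0) v) : nat)%:Z
      - (absTr p (a * intercept None v) : nat)%:Z
      + (absTr p (- (a * intercept (Some 1) v)) : nat)%:Z).
    have -> : absTr p (- (a * intercept (Some 1) v)) =
        absTr p (a * intercept None v) - absTr p (a * intercept (Some 0) v).
      by rewrite -absTrB intercept1; congr absTr; ring.
    by rewrite -(ltn_FpE p_pr) /q qE natz mulrCA.
  rewrite mulrDl below_q /G 2!mulrDl /A' /B' /C' !divzK // -[q]natz mulr_natr muE.
  by rewrite -/e; ring.
(* The remaining constant is a multiple of [q], as evaluation at the origin shows; its quotient is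
   put into [A']. *)
exists a, (fun x => A' x + (mu 0 - (below a 0)%:R - G 0)), B', C' => v.
apply: (mulIf (lt0r_neq0 q_gt0)); rewrite -/q GE.
transitivity (((below a v)%:R + G v) * q + (mu 0 * q - ((below a 0)%:R + G 0) * q)).
  by rewrite (GE 0); ring.
by rewrite /G; ring.
Qed.

Lemma ZL_sum (Ds : {set {set {set 'cV[F]_2}}}) (f g : {ffun 'cV[F]_2 -> int}) :
  ZL (AG F) Ds f -> ZL (AG F) Ds g -> ZL (AG F) Ds (f + g).
Proof.
case=> c -> [c' ->]; exists (fun l => c l + c' l); apply/ffunP => v.
by rewrite !ffunE -big_split /=; apply: eq_bigr => l _; rewrite mulrDl.
Qed.

Lemma ZL_intercept (Ds : {set {set {set 'cV[F]_2}}}) d (u : F -> int) : AGdir d \in Ds ->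
  ZL (AG F) Ds [ffun v => u (intercept d v)].
Proof.
(* The line of intercept [b] gets the coefficient [u b], and lines of other directions get [0]. *)
move=> dDs; exists (fun l => if [pick b | l == AGline d b] is Some b then u b else 0).
apply/ffunP => v; rewrite !ffunE.
have dirE b : dir (AG F) (AGline d b) = AGdir d.
  have bL : AGline d b \in AG F by apply/bigcupP; exists d => //; apply: imset_f.
  have dL : dir (AG F) (AGline d b) \in directions (AG F) by apply: imset_f.
  have := dL; rewrite directions_AG => /imsetP[e _ eE].
  have : AGline d b \in AGdir e by rewrite -eE inE bL /parallel eqxx.
  case/imsetP => c _ bc; rewrite eE; have [-> //|de] := eqVneq d e.
  (* A line belonging to two distinct directions would meet itself in a single point, against
     [q > 1]. *)
  move: q_gt1; have [_ crossAG _] := plane_of_directions_AG F.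
  rewrite -(card_AGline d b) -[AGline d b]setIid (crossAG (AGdir d) (AGdir e)) //.
  - by rewrite directions_AG imset_f.
  - by rewrite directions_AG imset_f.
  - by rewrite (inj_eq (@AGdir_inj F)).
  - exact: imset_f.
  - by rewrite bc imset_f.
rewrite (bigD1 (AGline d (intercept d v))) /=; last first.
  rewrite dirE dDs andbT; apply/bigcupP; exists d => //; exact: imset_f.
rewrite big1 => [|l /andP[_ lv]]; last first.
  case: pickP => [b /eqP lE|]; last by rewrite mul0r.
  rewrite ffunE lE mem_AGline; case: eqP => [vb|]; last by rewrite mulr0.
  by rewrite lE vb eqxx in lv.
case: pickP => [b /eqP/AGline_inj <-|/(_ (intercept d v))]; last by rewrite eqxx.
by rewrite ffunE mem_AGline eqxx mulr1 addr0.
Qed.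

End ThreeDirections.

(** * Ordinary sets without full special lines *)

Section OrdinarySets.
Variables (p h : nat) (F : finFieldType).
Hypotheses (p_pr : prime p) (cardF : #|F| = (p ^ h)%N).
Implicit Types (v w : 'cV[F]_2) (mu : {ffun 'cV[F]_2 -> int}) (d e : option F).

Let q_gt1 : (1 < #|F|)%N := finNzRing_gt1 F.
Let e_gt0 : (0 < #|F| %/ p)%N.
Proof.
have := card_F_factor cardF.
by case: (#|F| %/ p)%N => // E; move: q_gt1; rewrite E.
Qed.
Let qE : #|F|%:Z = (#|F| %/ p)%N%:Z * p%:Z.
Proof. by rewrite {1}(card_F_factor cardF) PoszM. Qed.

Local Notation nu c := (Posz (nat_of_ord (c%R : 'F_p))).

Definition special_slope d : bool := d \in [:: None; Some 0; Some 1].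

Lemma special_slopeN : special_slope None. Proof. exact: mem_head. Qed.
Lemma special_slope0 : special_slope (Some 0). Proof. by rewrite /special_slope !inE eqxx. Qed.
Lemma special_slope1 : special_slope (Some 1). Proof. by rewrite /special_slope !inE eqxx !orbT. Qed.

Lemma ordinary_line_bounds mu e b : ordinary_set mu ->
  (exists2 v, intercept e v = b & mu v = 0) ->
  0 <= meet_size mu (AGline e b) < #|F|%:Z.
Proof.
move=> mu01 [v vb mu0]; have mu_ge0 w : 0 <= mu w by case: (mu01 w) => ->.
rewrite meet_sizeE sumr_ge0 //= (bigD1 v) ?vb //= mu0 add0r.
have : \sum_(w | (intercept e w == b) && (w != v)) mu w
       <= \sum_(w | (intercept e w == b) && (w != v)) 1%:Z.
  by apply: ler_sum => w _; case: (mu01 w) => ->.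
move/le_lt_trans; apply; rewrite sumr_const natz ltz_nat -(card_AGline e b).
apply: proper_card; apply/properP; split.
  by apply/subsetP => w; rewrite unfold_in mem_AGline => /andP[].
by exists v; rewrite ?mem_AGline ?vb // unfold_in eqxx andbF.
Qed.

(** An integer in [[0, q)] is known from its residue modulo [q = e p]. Adding a multiple of [e] to
    [m0] keeps the remainder modulo [e], and the range forces the quotient to be the representative
    modulo [p]. *)
Lemma range_mod_q (m m0 : int) (z : nat) (s : int) : 0 <= m < #|F|%:Z ->
  (#|F| %| m - m0 - s * ((#|F| %/ p)%N%:Z * z%:Z))%Z ->
  m = (m0 %% (#|F| %/ p)%N)%Z
      + (#|F| %/ p)%N%:Z * nu ((m0 %/ (#|F| %/ p)%N)%Z + s * z%:Z)%:~R.
Proof.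
move=> bd /dvdzP[w]; rewrite (val_Fp_int p_pr); move: bd; rewrite qE.
move: (#|F| %/ p)%N e_gt0 => e e0 bd E.
have e0' : 0 < e%:Z by [].
have r0 := modz_ge0 m0 (lt0r_neq0 e0'); have r1 := ltz_pmod m0 e0'.
move: E r0 r1; rewrite {1}(divz_eq m0 e); move: (m0%R %% e)%Z (m0%R %/ e)%Z => r M E r0 r1.
have [T TE] : exists T, M + s * z%:Z = - w * p%:Z + T.
  by exists (M + s * z%:Z + w * p%:Z); ring.
have mE : m = r + e%:Z * T.
  have -> : T = M + s * z%:Z + w * p%:Z by rewrite TE; ring.
  have -> : m = w * (e%:Z * p%:Z) + (M * e%:Z + r) + s * (e%:Z * z%:Z) by rewrite -E; ring.
  by ring.
rewrite TE modzMDl modz_small //; move: bd; rewrite mE => /andP[b0 b1].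
have T0 : 0 <= T.
  rewrite leNgt; apply/negP => T0; have : e%:Z * T <= e%:Z * -1 by nia.
  lia.
have T1 : T < p%:Z.
  rewrite ltNge; apply/negP => T1; have : e%:Z * p%:Z <= e%:Z * T by nia.
  lia.
by rewrite T0 T1.
Qed.

(** The line sums lie in [[0, q)], so the congruences give them exactly. A suitable choice of origin
    leaves two unknown constants, [s] and [u], and the bounds on [mu] at two well-chosen points
    determine both. *)
Lemma lift_of_no_full_line mu (A B C : F -> int) k : ordinary_set mu ->
  (forall v, mu v *+ #|F| = A (intercept None v) + B (intercept (Some 0) v)
                            + C (intercept (Some 1) v) + k) ->
  (forall e b, special_slope e -> exists2 v, intercept e v = b & mu v = 0) ->
  (forall v, mu v = 0) \/
  exists a v0, a != 0 /\ forall v, mu v = (below p a (v - v0))%:R.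
Proof.
move=> mu01 /normalize_decomposition[{}k muE] no_full.
pose q := #|F|%:Z; pose e := (#|F| %/ p)%N%:Z; pose m d b := meet_size mu (AGline d b).
have m_bounds d b : special_slope d -> 0 <= m d b < q.
  by move=> sd; apply: ordinary_line_bounds => //; apply: no_full.
have {}muE v : mu v * q = m None (intercept None v) + m (Some 0) (intercept (Some 0) v)
                          + m (Some 1) (intercept (Some 1) v) + k.
  by rewrite -muE -[q]natz mulr_natr.
have muE' v : mu v *+ #|F| = m None (intercept None v)
      + m (Some 0) (intercept (Some 0) v) + m (Some 1) (intercept (Some 1) v) + k.
  by rewrite -muE -[q]natz mulr_natr.
have [a aE] := linear_mod_q p_pr cardF (linear_mod_q_plane muE').
have q0 : q != 0 by rewrite lt0r_neq0 // /q ltz_nat ltnW.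
have mN x : m None x = (m None 0%R %% e)%Z
    + e * nu ((m None 0%R %/ e)%Z + -1 * nu (absTr p (a * x)))%:~R.
  apply: range_mod_q; first exact: m_bounds special_slopeN.
  by have [H _ _] := aE x; move: H; congr (_ %| _)%Z; ring.
have m0 y : m (Some 0) y = (m (Some 0%R) 0%R %% e)%Z
    + e * nu ((m (Some 0%R) 0%R %/ e)%Z + 1 * nu (absTr p (a * y)))%:~R.
  apply: range_mod_q; first exact: m_bounds special_slope0.
  by have [_ H _] := aE y; move: H; congr (_ %| _)%Z; ring.
have m1 t : m (Some 1) t = (m (Some 1%R) 0%R %% e)%Z
    + e * nu ((m (Some 1%R) 0%R %/ e)%Z + 1 * nu (absTr p (- (a * t))))%:~R.
  apply: range_mod_q; first exact: m_bounds special_slope1.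
  by have [_ _ H] := aE t; move: H; congr (_ %| _)%Z; ring.
(* For [a = 0] all line sums are constant, hence so is [mu], which vanishes somewhere. *)
have [a0|a0] := eqVneq a 0.
  left=> v; have [w _ w0] := no_full None 0 special_slopeN.
  apply: (mulIf q0); rewrite mul0r -(mul0r q) -w0 !muE.
  rewrite !(mN (intercept None _)) !(m0 (intercept _ _)) !(m1 (intercept _ _)).
  by rewrite a0 !mul0r.
right; exists a.
move: mN m0 m1; move: (m None 0%R %% e)%Z (m None 0%R %/ e)%Z => rN MN.
move: (m (Some 0%R) 0%R %% e)%Z (m (Some 0%R) 0%R %/ e)%Z => r0 M0.
move: (m (Some 1%R) 0%R %% e)%Z (m (Some 1%R) 0%R %/ e)%Z => r1 M1 mN m0 m1.
(* With this origin the arguments of [nu] become [-1 - X], [Y] and [X - Y + s]; the shift by [1] is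
   there because [nu (-1 - X) = p - 1 - nu X]. *)
have [x0 x0E] := absTr_surj p_pr cardF (MN%:~R + 1) a0.
have [y0 y0E] := absTr_surj p_pr cardF (- M0%:~R) a0.
have [//|v0 v0x v0y] := @intercept_meet F None (Some 0) x0 y0.
exists v0; split=> //.
pose X v : 'F_p := absTr p (a * intercept None (v - v0)).
pose Y v : 'F_p := absTr p (a * intercept (Some 0) (v - v0)).
pose s : 'F_p := M1%:~R + MN%:~R + 1 + M0%:~R.
pose K := rN + r0 + r1 + k.
have trN v : absTr p (a * intercept None v) = X v + (MN%:~R + 1).
  by rewrite -x0E -v0x -(absTrD p_pr cardF) /X interceptB; congr absTr; ring.
have tr0 v : absTr p (a * intercept (Some 0) v) = Y v - M0%:~R.
  by rewrite -y0E -v0y -(absTrD p_pr cardF) /Y interceptB; congr absTr; ring.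
have tr1 v : absTr p (- (a * intercept (Some 1) v))
             = X v - Y v + (MN%:~R + 1 + M0%:~R).
  transitivity (absTr p (a * intercept None v) - absTr p (a * intercept (Some 0) v)).
    by rewrite -(absTrB p_pr cardF) intercept1; congr absTr; ring.
  by rewrite trN tr0; ring.
have opp_nu (c : 'F_p) : nu (- 1 - c) = p%:Z - 1 - nu c.
  rewrite -[in LHS](Fp_intK c) -(opprD 1) -[1]/(1%:~R) -intrD -intrN (val_Fp_int p_pr).
  have cp := ltn_Fp p_pr c; rewrite -modzDr modz_small; lia.
have mu_nu v : mu v * q = K + e * (p%:Z - 1 - nu (X v) + nu (Y v)
                                   + nu (X v - Y v + s)).
  rewrite muE mN m0 m1 !intrD !intrM !Fp_intK trN tr0 tr1 -opp_nu.
  rewrite (_ : MN%:~R + _ = - 1 - X v); last by rewrite rmorphN1; ring.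
  rewrite (_ : M0%:~R + _ = Y v); last by ring.
  rewrite (_ : M1%:~R + _ = X v - Y v + s); last by rewrite /s; ring.
  by rewrite /K; ring.
have e_neq0 : e != 0 by rewrite eqz_nat -lt0n.
(* The constant [K / e], defined through the value at [v0] so that no divisibility has to be
   shown. *)
pose u := mu v0 * p%:Z - (p%:Z - 1 - nu (X v0) + nu (Y v0) + nu (X v0 - Y v0 + s)).
have muP v : mu v * p%:Z = u + (p%:Z - 1 - nu (X v) + nu (Y v) + nu (X v - Y v + s)).
  apply: (mulfI e_neq0); have := mu_nu v; have := mu_nu v0.
  rewrite /u; move: (_ + nu (X v - Y v + s)) (_ + nu (X v0 - Y v0 + s)) => T T0.
  rewrite /q qE -/e => E0 E; rewrite mulrCA E.
  transitivity (mu v0 * (e * p%:Z) - e * T0 + e * T); last by ring.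
  by rewrite E0; ring.
have XE v x : intercept None v = x0 + x -> X v = absTr p (a * x).
  by move=> vx; rewrite /X interceptB vx v0x addrAC subrr add0r.
have YE v y : intercept (Some 0) v = y0 + y -> Y v = absTr p (a * y).
  by move=> vy; rewrite /Y interceptB vy v0y addrAC subrr add0r.
(* At a point with [X = 0] and [mu = 0], the terms added to [u + p - 1] are nonnegative. *)
have u_le : u <= 1 - p%:Z.
  have [v vx mu0] := no_full None (x0 + 0) special_slopeN.
  have := muP v; rewrite mu0 mul0r (XE _ _ vx) mulr0 (absTr0 p_pr cardF).
  move: (nat_of_ord (Y v)) (nat_of_ord (_ + s)) => y z /=; lia.
have [x1 x1E] := absTr_surj p_pr cardF (- 1) a0.
(* At [X = -1], [Y = 0] only [u + nu (s - 1)] remains; being nonnegative with [u <= 1 - p], it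
   forces [nu (s - 1) = p - 1] and [u = 1 - p]. *)
have [//|v1 v1x v1y] := @intercept_meet F None (Some 0) (x0 + x1) (y0 + 0).
have nuN1 : nu (- 1) = p%:Z - 1 by rewrite -[-1]subr0 opp_nu /= subr0.
have s_max : p%:Z - 1 <= nu (s - 1) .
  have mu_ge0 : 0 <= mu v1 * p%:Z by case: (mu01 v1) => ->.
  move: mu_ge0; rewrite muP (XE _ _ v1x) (YE _ _ v1y) x1E mulr0 (absTr0 p_pr cardF).
  rewrite (_ : - 1 - 0 + s = s - 1) ?nuN1; last by ring.
  by move: (nat_of_ord (s - 1)) => z /=; lia.
have s_lt := ltn_Fp p_pr (s - 1).
have s0 : s = 0.
  apply: (addIr (- 1)); rewrite add0r; apply/val_inj.
  have [//] : nu (s - 1) = nu (- 1).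
  by rewrite nuN1; move: s_lt s_max; move: (nat_of_ord (s - 1)) => z; lia.
have uE : u = 1 - p%:Z.
  have mu_ge0 : 0 <= mu v1 * p%:Z by case: (mu01 v1) => ->.
  move: mu_ge0; rewrite muP (XE _ _ v1x) (YE _ _ v1y) x1E mulr0 (absTr0 p_pr cardF).
  rewrite (_ : - 1 - 0 + s = s - 1) ?nuN1; last by ring.
  by move: s_lt; move: (nat_of_ord (s - 1)) => z /=; lia.
move=> v; have p_neq0 : p%:Z != 0 by rewrite eqz_nat -lt0n prime_gt0.
apply: (mulIf p_neq0); rewrite muP uE s0 addr0 natz (ltn_FpE p_pr) -/(X v) -/(Y v).
by ring.
Qed.

End OrdinarySets.

(** * Normalization by homotheties and removal of full lines *)

Section Conclusion.
Variables (p h : nat) (F : finFieldType).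
Hypotheses (p_pr : prime p) (cardF : #|F| = (p ^ h)%N).
Implicit Types (v w : 'cV[F]_2) (mu : {ffun 'cV[F]_2 -> int}) (d e : option F).

Definition full mu d (b : F) : bool :=
  [forall v, (intercept d v == b) ==> (mu v == 1)].

Lemma fullP mu d b :
  reflect (forall v, intercept d v = b -> mu v = 1) (full mu d b).
Proof.
apply: (iffP forallP) => H v; last by apply/implyP => /eqP/H->.
by move=> vb; have := H v; rewrite vb eqxx => /eqP.
Qed.

Definition strip mu d : {ffun 'cV[F]_2 -> int} :=
  [ffun v => mu v - (full mu d (intercept d v))%:R].

Lemma strip_ordinary mu d : ordinary_set mu -> ordinary_set (strip mu d).
Proof.
move=> mu01 v; rewrite ffunE; case: fullP => [->|_]; rewrite ?subrr ?subr0 //.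
by left.
Qed.

(* If one of the three directions has a full line, strip the full lines of that
   direction: all the lines of the other directions meet a stripped line. *)
Lemma strip_no_full_line mu : ordinary_set mu -> exists2 d, special_slope d &
  forall e b, special_slope e -> exists2 v, intercept e v = b & strip mu d v = 0.
Proof.
move=> mu01.
have not_full d b : ~~ full mu d b -> exists2 v, intercept d v = b & strip mu d v = 0.
  move=> nf; have := nf; rewrite negb_forall => /existsP[v].
  rewrite negb_imply => /andP[/eqP vb mu1]; exists v => //.
  rewrite ffunE vb (negPf nf) subr0.
  by case: (mu01 v) mu1 => -> //; rewrite eqxx.
have [[d sd [b0 fd]]|nofull] :
    (exists2 d, special_slope d & exists b, full mu d b) \/
    (forall d b, special_slope d -> ~~ full mu d b).
  case: (boolP [exists d, special_slope d && [exists b, full mu d b]]).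
    by case/existsP => d /andP[sd /existsP[b fb]]; left; exists d => //; exists b.
  move=> H; right=> d b sd; apply: contra H => fb; apply/existsP; exists d.
  by rewrite sd; apply/existsP; exists b.
- exists d => // e b se; have [ed|ed] := eqVneq d e.
    rewrite -ed; have [fb|/not_full //] := boolP (full mu d b).
    have [v vb] := intercept_surj d b; exists v => //.
    by rewrite ffunE vb fb (fullP _ _ _ fb v vb) subrr.
  have [v vb0 vb] := intercept_meet b0 b ed; exists v => //.
  by rewrite ffunE vb0 fd (fullP _ _ _ fd v vb0) subrr.
(* With no full line at all, stripping leaves [mu] unchanged. *)
- exists None => [|e b se]; first exact: special_slopeN.
  have := nofull e b se; rewrite negb_forall => /existsP[v].
  rewrite negb_imply => /andP[/eqP vb mu1]; exists v => //.
  rewrite ffunE (negPf (nofull _ _ (special_slopeN F))) subr0.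
  by case: (mu01 v) mu1 => -> //; rewrite eqxx.
Qed.

Lemma homothety_perm (a : F) v0 : a != 0 -> exists g : {perm 'cV[F]_2},
  affine_transformation g /\ forall v, g v = a *: (v - v0).
Proof.
move=> a0; have ginj : injective (fun v => a *: (v - v0)).
  by move=> v w /(scalerI a0)/addIr.
exists (perm ginj); split=> [|v]; last by rewrite permE.
exists a%:M, (- (a *: v0)); split=> [|v].
  by rewrite unitmxE det_scalar unitrX // unitfE.
by rewrite permE scalerBr mul_scalar_mx.
Qed.

Section Decomposed.
Variables (mu : {ffun 'cV[F]_2 -> int}) (A B C : F -> int) (k : int).
Hypothesis muE : forall v, mu v *+ #|F| =
  A (intercept None v) + B (intercept (Some 0) v) + C (intercept (Some 1) v) + k.

Let AG3 := [set AGdir (None : option F); AGdir (Some (0 : F)); AGdir (Some (1 : F))].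

(** The homothety of ratio [a] carries [below a] to the lift of [K] and permutes the lines of each
    direction; for [a = 0] only the combination of lines is left. *)
Lemma affine_ZL_or_Lift : exists g : {perm 'cV[F]_2}, affine_transformation g /\
  (ZL (AG F) AG3 (mimage g mu) \/
   exists2 nu : {ffun 'cV[F]_2 -> int}, ZL (AG F) AG3 nu &
     mimage g mu = charfun (Lift F (Kset p)) + nu).
Proof.
have [a [A' [B' [C' mu_a]]]] := lift_decomposition p_pr cardF muE.
have ZLsum (A1 B1 C1 : F -> int) : ZL (AG F) AG3
    ([ffun v => A1 (intercept None v)] + [ffun v => B1 (intercept (Some 0) v)]
     + [ffun v => C1 (intercept (Some 1) v)]).
  by apply: ZL_sum; [apply: ZL_sum|]; apply: ZL_intercept; rewrite /AG3 !inE eqxx ?orbT.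
have [a0|a0] := eqVneq a 0.
  have [g [affg gE]] := homothety_perm 0 (oner_neq0 F); exists g; split=> //; left.
  suff -> : mimage g mu = [ffun v => A' (intercept None v)]
     + [ffun v => B' (intercept (Some 0) v)] + [ffun v => C' (intercept (Some 1) v)].
    exact: ZLsum.
  apply/ffunP => v; have [w ->] : exists w, v = g w by exists (g^-1%g v); rewrite permKV.
  by rewrite !ffunE permK mu_a a0 /below !mul0r ltnn add0r gE scale1r subr0.
have [g [affg gE]] := homothety_perm 0 a0; exists g; split=> //; right.
exists ([ffun v => A' (a^-1 * intercept None v)]
     + [ffun v => B' (a^-1 * intercept (Some 0) v)]
     + [ffun v => C' (a^-1 * intercept (Some 1) v)]).
  exact: (ZLsum (fun x => A' (a^-1 * x)) (fun x => B' (a^-1 * x)) (fun x => C' (a^-1 * x))).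
apply/ffunP => v; have [w ->] : exists w, v = g w by exists (g^-1%g v); rewrite permKV.
rewrite !ffunE permK mu_a mem_Lift gE subr0 /below !interceptZ !mul1r.
by rewrite !mulKf.
Qed.

(** Stripping the full lines of one slope changes only the function of that slope in the
    decomposition, so what remains is empty or a copy of the lift. The lift avoids the stripped
    lines, on which the remainder is zero. *)
Lemma affine_Lift_union : ordinary_set mu ->
  (forall d, special_slope d -> ~~ equidistributed mu (AGdir d)) ->
  exists (D : {set {set 'cV[F]_2}}) (B : {set {set 'cV[F]_2}}),
    [/\ D \in directions (AG F), B \subset D,
        forall l : {set 'cV[F]_2}, l \in B -> [disjoint l & Lift F (Kset p)]
      & affinely_equivalent mu (charfun (Lift F (Kset p) :|: cover B))].
Proof.
move=> mu01 neq; have [d sd no_full] := strip_no_full_line mu01.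
pose u b : int := (full mu d b)%:R.
have stripE v : mu v = strip mu d v + u (intercept d v).
  by rewrite ffunE subrK.
have [A' [B' [C' strip_dec]]] : exists A' B' C' : F -> int,
    forall v, strip mu d v *+ #|F| = A' (intercept None v)
      + B' (intercept (Some 0) v) + C' (intercept (Some 1) v) + k.
  have E v : strip mu d v *+ #|F| = mu v *+ #|F| - u (intercept d v) *+ #|F|.
    by rewrite stripE mulrnDl addrK.
  move: sd; rewrite /special_slope !inE => /or3P[]/eqP dE; rewrite {}dE in E *.
  - by exists (fun x => A x - u x *+ #|F|), B, C => v; rewrite E muE; ring.
  - by exists A, (fun x => B x - u x *+ #|F|), C => v; rewrite E muE; ring.
  - by exists A, B, (fun x => C x - u x *+ #|F|) => v; rewrite E muE; ring.
have [strip0|[a [v0 [a0 stripL]]]] :=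
    lift_of_no_full_line p_pr cardF (strip_ordinary d mu01) strip_dec no_full.
  (* If nothing remains, [mu] depends on the intercept of slope [d] alone, and is then
     equidistributed from any other special slope. *)
  have [e se ed] : exists2 e, special_slope e & e != d.
    case: (d) => [m|]; first by exists None; rewrite ?special_slopeN.
    by exists (Some 0); rewrite ?special_slope0.
  case/negP: (neq e se); apply/equidistributed_AGP => b c.
  have mE v : mu v = u (intercept d v) by rewrite stripE strip0 add0r.
  by rewrite !meet_sizeE !(eq_bigr _ (fun v _ => mE v)) !sum_intercept.
have [g [affg gE]] := homothety_perm v0 a0.
(* The images under [g] of the full lines of slope [d]. *)
pose B1 := [set AGline d (intercept d (g v)) |
  v in [pred v | full mu d (intercept d v)]].
exists (AGdir d), B1.
have mem_cover w : (g w \in cover B1) = full mu d (intercept d w).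
  apply/bigcupP/idP => [[_ /imsetP[v fv ->]]|fw].
    rewrite mem_AGline !gE !interceptZ !interceptB => /eqP/(mulfI a0)/addIr->.
    by [].
  by exists (AGline d (intercept d (g w))); rewrite ?mem_AGline //; apply/imsetP; exists w.
have strip_mem w : (g w \in Lift F (Kset p))%:R = strip mu d w :> int.
  by rewrite stripL mem_Lift gE /below !interceptZ !mul1r.
split.
- by rewrite directions_AG imset_f.
- by apply/subsetP => _ /imsetP[v _ ->]; apply: imset_f.
- move=> l lB; rewrite -setI_eq0; apply/set0Pn => -[x /setIP[xl xL]].
  have [w xE] : exists w, x = g w by exists (g^-1%g x); rewrite permKV.
  have fw : full mu d (intercept d w).
    by rewrite -mem_cover -xE; apply/bigcupP; exists l.
  have := strip_mem w; rewrite -xE xL ffunE fw (fullP _ _ _ fw w erefl) subrr.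
  by move/eqP; rewrite oner_eq0.
exists g; split=> //; apply/ffunP => x.
have [w ->] : exists w, x = g w by exists (g^-1%g x); rewrite permKV.
rewrite !ffunE permK in_setU mem_cover [LHS]stripE -strip_mem /u.
case: (boolP (full _ _ _)) => [fw|_]; last by rewrite addr0 orbF.
have := strip_mem w; rewrite ffunE fw (fullP _ _ _ fw w erefl) subrr.
by case: (_ \in _).
Qed.

End Decomposed.

End Conclusion.

(** * Comparison of the two planes *)

Lemma exactly_three_decompositionP (P : finType) (L : {set {set P}}) n D1 D2 D3
    (mu : {ffun P -> int}) :
  plane_of_directions (directions L) -> (1 < n)%N -> #|P| = (n * n)%N ->
  (forall D l, D \in directions L -> l \in D -> #|l| = n) ->
  D1 \in directions L -> D2 \in directions L -> D3 \in directions L ->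
  D1 != D2 -> D1 != D3 -> D2 != D3 ->
  inequidistributed_dirs L mu = [set D1; D2; D3] <->
  [/\ ~~ equidistributed mu D1, ~~ equidistributed mu D2,
      ~~ equidistributed mu D3 &
      exists k : int, forall x,
        mu x *+ n = meet_size mu (pblock D1 x) + meet_size mu (pblock D2 x)
                    + meet_size mu (pblock D3 x) + k].
Proof.
move=> planeL n_gt1 cardP card_line D1L D2L D3L D12 D13 D23.
have outP := equidistributed_outsideP planeL n_gt1 cardP card_line D1L D2L D3L D12 D13 D23 mu.
split=> [/exactly_threeP[]// n1 n2 n3 /outP|[n1 n2 n3 /outP out]] //.
by apply/exactly_threeP.
Qed.

Theorem corollary4p11 (p h : nat) (F : finFieldType) (P : finType)
    (L : {set {set P}}) (d1 d2 d3 : {set {set P}})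
    (p_prime : prime p) (cardF : #|F| = (p ^ h)%N)
    (L_translation : translation_plane L) (L_order : plane_order L #|F|)
    (d1_dir : d1 \in directions L) (d2_dir : d2 \in directions L)
    (d3_dir : d3 \in directions L)
    (d12 : d1 != d2) (d13 : d1 != d3) (d23 : d2 != d3) :
  let AG3 := [set AGdir (None : option F); AGdir (Some (0 : F));
                  AGdir (Some (1 : F))] in
  let representation (f : P -> 'cV[F]_2) :=
    [/\ bijective f, transport f d1 = AGdir None,
        transport f d2 = AGdir (Some 0) & transport f d3 = AGdir (Some 1)] in
  (exists f : P -> 'cV[F]_2, representation f) /\
  forall f : P -> 'cV[F]_2, representation f ->
  forall mu : {ffun 'cV[F]_2 -> int},
    let exactly_d123 :=
      inequidistributed_dirs (transport f L) mu =
      [set transport f d1; transport f d2; transport f d3] in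
    (exactly_d123 <-> inequidistributed_dirs (AG F) mu = AG3) /\
    (exactly_d123 ->
      (exists g : {perm 'cV[F]_2}, affine_transformation g /\
        (ZL (AG F) AG3 (mimage g mu) \/
         exists2 nu : {ffun 'cV[F]_2 -> int}, ZL (AG F) AG3 nu &
           mimage g mu = charfun (Lift F (Kset p)) + nu)) /\
      (ordinary_set mu ->
        exists (D : {set {set 'cV[F]_2}}) (B : {set {set 'cV[F]_2}}),
          [/\ D \in directions (AG F), B \subset D,
              forall l : {set 'cV[F]_2}, l \in B ->
                [disjoint l & Lift F (Kset p)]
            & affinely_equivalent mu
                (charfun (Lift F (Kset p) :|: cover B))])).
Proof.
move=> AG3 representation; have [affL transL] := L_translation.
have q_gt1 : (1 < #|F|)%N := finNzRing_gt1 F.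
have L_n0 : set0 \notin L.
  by apply/negP => /L_order; rewrite cards0 => q0; rewrite -q0 in q_gt1.
have planeL := affine_plane_directions affL L_n0.
have card_line D l : D \in directions L -> l \in D -> #|l| = #|F|.
  by move=> DL /(mem_directions affL DL)[lL _]; apply: L_order.
have cardP := card_affine_plane planeL card_line (ltnW q_gt1) d1_dir d2_dir d12.
split.
  apply: (exists_representation p_prime cardF planeL cardP card_line) => // x y.
  have [g [tg gxy]] := transL x y.
  by have [dg fg] := translation_dilatation affL L_n0 tg; exists g.
move=> f [f_bij f1 f2 f3] mu; have f_inj := bij_inj f_bij.
have planeT := plane_of_directions_transport f_inj f_bij planeL.
rewrite -(directions_transport f_inj) in planeT.
have dirT D : D \in directions L -> transport f D \in directions (transport f L).
  by move=> DL; rewrite directions_transport // imset_f.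
have card_lineT D l : D \in directions (transport f L) -> l \in D -> #|l| = #|F|.
  rewrite directions_transport // => /imsetP[E EL ->] /imsetP[m mE ->].
  by rewrite card_imset // (card_line E).
have card_lineAG D l : D \in directions (AG F) -> l \in D -> #|l| = #|F|.
  by rewrite directions_AG => /imsetP[d _ ->] /imsetP[b _ ->]; apply: card_AGline.
have dirAG d : AGdir d \in directions (AG F) by rewrite directions_AG imset_f.
have neqT (D E : {set {set P}}) : D != E -> transport f D != transport f E.
  by rewrite (inj_eq (transport_inj f_inj)).
have decT := exactly_three_decompositionP mu planeT q_gt1 (card_cV2 F) card_lineT
  (dirT _ d1_dir) (dirT _ d2_dir) (dirT _ d3_dir) (neqT _ _ d12) (neqT _ _ d13) (neqT _ _ d23).
have n12 : AGdir None != AGdir (Some (0 : F)) by rewrite -f1 -f2 neqT.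
have n13 : AGdir None != AGdir (Some (1 : F)) by rewrite -f1 -f3 neqT.
have n23 : AGdir (Some 0) != AGdir (Some (1 : F)) by rewrite -f2 -f3 neqT.
have decAG := exactly_three_decompositionP mu (plane_of_directions_AG F) q_gt1
  (card_cV2 F) card_lineAG (dirAG _) (dirAG _) (dirAG _) n12 n13 n23.
(* Once the three directions are identified, both planes give the same condition, as it mentions no
   other line. *)
rewrite f1 f2 f3 in decT *; split; first exact: iff_trans decT (iff_sym decAG).
move=> /decT[n1 n2 n3 [k muE]].
pose m d b := meet_size mu (AGline d b).
have {}muE v : mu v *+ #|F| = m None (intercept None v)
    + m (Some 0) (intercept (Some 0) v) + m (Some 1) (intercept (Some 1) v) + k.
  by rewrite muE !pblock_AGdir.
split; first exact: (affine_ZL_or_Lift p_prime cardF muE).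
move=> mu01; apply: (affine_Lift_union p_prime cardF muE mu01) => d.
by rewrite /special_slope !inE => /or3P[]/eqP->.
Qed.
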